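(* There are infinitely many isomorphism classes of complex $2$-dimensional compatible pre-Lie algebras. They are described explicitly by the following list of $6$ three-parameter families, $14$ two-parameter families, $13$ one-parameter families and $8$ additional algebras. Every nonzero $2$-dimensional compatible pre-Lie algebra over $\mathbb{C}$ (with multiplications $\cdot$ and $\ast$) is isomorphic to one and only one of the following algebras with basis $e_1,e_2$, with the exceptions to uniqueness stated after the list (parameters $\alpha,\beta,\gamma$ range over $\mathbb{C}$, subject to the indicated restrictions; products of basis elements not listed are zero): $\mathcal{C}_{01}$: $e_1\ast e_1=e_1+e_2,\ e_2\ast e_1=e_2$. $\mathcal{C}_{02}$: $e_1\ast e_1=e_1+e_2,\ e_1\ast e_2=e_2$. $\mathcal{C}_{03}$: $e_1\ast e_1=e_2$. $\mathcal{C}_{04}$: $e_2\ast e_1=e_1$. $\mathcal{C}_{05}^{\alpha}$: $e_1\ast e_1=e_1,\ e_1\ast e_2=\alpha e_2$. $\mathcal{C}_{06}^{\alpha}$: $e_1\ast e_1=e_1,\ e_1\ast e_2=\alpha e_2,\ e_2\ast e_1=e_2$. $\mathcal{C}_{07}$: $e_1\ast e_1=e_1,\ e_2\ast e_2=e_2$. $\mathcal{C}_{08}$: $e_1\ast e_1=e_1,\ e_1\ast e_2=2e_2,\ e_2\ast e_1=\frac12 e_1+e_2,\ e_2\ast e_2=e_2$. $\mathcal{C}_{09}^{\alpha,\beta\neq0}$: $e_1\cdot e_1=e_1+e_2,\ e_2\cdot e_1=e_2$; $e_1\ast e_1=\alpha e_1,\ e_1\ast e_2=\beta e_2,\ e_2\ast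 e_1=\alpha e_2$. $\mathcal{C}_{10}^{\alpha,\beta}$: $e_1\cdot e_1=e_1+e_2,\ e_2\cdot e_1=e_2$; $e_1\ast e_1=\alpha e_1+\beta e_2,\ e_2\ast e_1=\alpha e_2$. $\mathcal{C}_{11}^{\alpha,\beta\neq\alpha}$: $e_1\cdot e_1=e_1+e_2,\ e_1\cdot e_2=e_2$; $e_1\ast e_1=\alpha e_1,\ e_1\ast e_2=\beta e_2$. $\mathcal{C}_{12}^{\alpha,\beta}$: $e_1\cdot e_1=e_1+e_2,\ e_1\cdot e_2=e_2$; $e_1\ast e_1=\alpha e_1+\beta e_2,\ e_1\ast e_2=\alpha e_2$. $\mathcal{C}_{13}^{\alpha}$: $e_1\cdot e_1=e_2$; $e_1\ast e_1=\alpha e_1,\ e_1\ast e_2=e_2,\ e_2\ast e_1=\alpha e_2$. $\mathcal{C}_{14}^{\alpha}$: $e_1\cdot e_1=e_2$; $e_1\ast e_1=e_1+\alpha e_2,\ e_2\ast e_1=e_2$. $\mathcal{C}_{15}^{\alpha}$: $e_1\cdot e_1=e_2$; $e_1\ast e_1=\alpha e_2$. $\mathcal{C}_{16}^{\alpha\neq1}$: $e_1\cdot e_1=e_2$; $e_1\ast e_1=e_1,\ e_1\ast e_2=\alpha e_2$. $\mathcal{C}_{17}^{\alpha}$: $e_1\cdot e_1=e_2$; $e_1\ast e_1=e_1+\alpha e_2,\ e_1\ast e_2=e_2$. $\mathcal{C}_{18}^{\alpha}$: $e_1\cdot e_1=e_2$; $e_1\ast e_1=\alpha e_2,\ e_1\ast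 e_2=e_1,\ e_2\ast e_1=e_1,\ e_2\ast e_2=e_2$. $\mathcal{C}_{19}^{\alpha}$: $e_1\cdot e_1=e_2$; $e_1\ast e_1=\alpha e_2,\ e_2\ast e_1=e_1,\ e_2\ast e_2=2e_2$. $\mathcal{C}_{20}^{\alpha,\beta}$: $e_2\cdot e_1=e_1$; $e_2\ast e_1=\alpha e_1,\ e_2\ast e_2=e_1+\beta e_2$. $\mathcal{C}_{21}^{\alpha,\beta}$: $e_2\cdot e_1=e_1$; $e_2\ast e_1=\alpha e_1,\ e_2\ast e_2=\beta e_2$. $\mathcal{C}_{22}^{\alpha\neq0,\beta}$: $e_2\cdot e_1=e_1$; $e_1\ast e_2=\alpha e_1,\ e_2\ast e_1=\beta e_1,\ e_2\ast e_2=e_1+\alpha e_2$. $\mathcal{C}_{23}^{\alpha\neq0,\beta}$: $e_2\cdot e_1=e_1$; $e_1\ast e_2=\alpha e_1,\ e_2\ast e_1=\beta e_1,\ e_2\ast e_2=\alpha e_2$. $\mathcal{C}_{24}^{\alpha,\beta,\gamma}$: $e_1\cdot e_1=e_1,\ e_1\cdot e_2=\alpha e_2$; $e_1\ast e_1=\beta e_1+e_2,\ e_1\ast e_2=\gamma e_2$. $\mathcal{C}_{25}^{\alpha,\beta,\gamma}$: $e_1\cdot e_1=e_1,\ e_1\cdot e_2=\alpha e_2$; $e_1\ast e_1=\beta e_1,\ e_1\ast e_2=\gamma e_2$. $\mathcal{C}_{26}^{\alpha}$: $e_1\cdot e_1=e_1,\ e_1\cdot e_2=\frac12 e_2$; $e_1\ast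 e_1=2\alpha e_1,\ e_1\ast e_2=\alpha e_2,\ e_2\ast e_2=e_1$. $\mathcal{C}_{27}^{\alpha,\beta}$: $e_1\cdot e_1=e_1,\ e_1\cdot e_2=\frac12 e_2$; $e_1\ast e_1=2\alpha e_1,\ e_1\ast e_2=e_1+\alpha e_2,\ e_2\ast e_1=2e_1,\ e_2\ast e_2=\beta e_1+e_2$. $\mathcal{C}_{28}$: $e_1\cdot e_1=e_1,\ e_1\cdot e_2=e_2$; $e_2\ast e_1=e_1,\ e_2\ast e_2=e_2$. $\mathcal{C}_{29}^{\alpha}$: $e_1\cdot e_1=e_1$; $e_1\ast e_1=\alpha e_1,\ e_2\ast e_2=e_2$. $\mathcal{C}_{30}^{\alpha,\beta}$: $e_1\cdot e_1=e_1$; $e_1\ast e_1=\alpha e_1+\beta e_2,\ e_1\ast e_2=e_1,\ e_2\ast e_1=e_1,\ e_2\ast e_2=e_2$. $\mathcal{C}_{31}^{\alpha,\beta,\gamma}$: $e_1\cdot e_1=e_1,\ e_1\cdot e_2=\alpha e_2,\ e_2\cdot e_1=e_2$; $e_1\ast e_1=\beta e_1+e_2,\ e_1\ast e_2=\gamma e_2,\ e_2\ast e_1=\beta e_2$. $\mathcal{C}_{32}^{\alpha,\beta,\gamma}$: $e_1\cdot e_1=e_1,\ e_1\cdot e_2=\alpha e_2,\ e_2\cdot e_1=e_2$; $e_1\ast e_1=\beta e_1,\ e_1\ast e_2=\gamma e_2,\ e_2\ast e_1=\beta e_2$. $\mathcal{C}_{33}$: $e_1\cdot e_1=e_1,\ e_2\cdot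 e_1=e_2$; $e_1\ast e_2=e_1,\ e_2\ast e_2=e_2$. $\mathcal{C}_{34}^{\alpha,\beta}$: $e_1\cdot e_1=e_1,\ e_1\cdot e_2=e_2,\ e_2\cdot e_1=e_2$; $e_1\ast e_1=\alpha e_1,\ e_1\ast e_2=\alpha e_2,\ e_2\ast e_1=\alpha e_2,\ e_2\ast e_2=e_1+\beta e_2$. $\mathcal{C}_{35}^{\alpha}$: $e_1\cdot e_1=e_1,\ e_1\cdot e_2=e_2,\ e_2\cdot e_1=e_2$; $e_1\ast e_1=\alpha e_1,\ e_1\ast e_2=\alpha e_2,\ e_2\ast e_1=\alpha e_2,\ e_2\ast e_2=e_2$. $\mathcal{C}_{36}^{\alpha,\beta}$: $e_1\cdot e_1=e_1,\ e_1\cdot e_2=2e_2,\ e_2\cdot e_1=e_2$; $e_1\ast e_1=\alpha e_1+\beta e_2,\ e_1\ast e_2=2\alpha e_2,\ e_2\ast e_1=e_1+\alpha e_2,\ e_2\ast e_2=2e_2$. $\mathcal{C}_{37}^{\alpha}$: $e_1\cdot e_1=e_1,\ e_1\cdot e_2=2e_2,\ e_2\cdot e_1=e_2$; $e_1\ast e_1=\alpha e_1,\ e_1\ast e_2=e_1+2\alpha e_2,\ e_2\ast e_1=2e_1+\alpha e_2,\ e_2\ast e_2=e_2$. $\mathcal{C}_{38}^{\alpha,\beta,\gamma}$: $e_1\cdot e_1=e_1,\ e_2\cdot e_2=e_2$; $e_1\ast e_1=(\gamma+\beta-\alpha)e_1-\beta e_2,\ e_1\ast e_2=\alpha e_1+\beta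 e_2,\ e_2\ast e_1=\alpha e_1+\beta e_2,\ e_2\ast e_2=-\alpha e_1+\gamma e_2$. $\mathcal{C}_{39}^{\alpha,\beta\neq\alpha}$: $e_1\cdot e_1=e_1,\ e_2\cdot e_2=e_2$; $e_1\ast e_1=\alpha e_1,\ e_2\ast e_2=\beta e_2$. $\mathcal{C}_{40}^{\alpha,\beta,\gamma}$: $e_1\cdot e_1=e_1,\ e_1\cdot e_2=2e_2,\ e_2\cdot e_1=\frac12 e_1+e_2,\ e_2\cdot e_2=e_2$; $e_1\ast e_1=\alpha e_1+\beta e_2,\ e_1\ast e_2=2\alpha e_2,\ e_2\ast e_1=\gamma e_1+\alpha e_2,\ e_2\ast e_2=2\gamma e_2$. $\mathcal{C}_{41}^{\alpha,\beta\neq0}$: $e_1\cdot e_1=e_1,\ e_1\cdot e_2=2e_2,\ e_2\cdot e_1=\frac12 e_1+e_2,\ e_2\cdot e_2=e_2$; $e_1\ast e_1=\alpha e_1,\ e_1\ast e_2=\beta e_1+2\alpha e_2,\ e_2\ast e_1=(2\beta+\frac12\alpha)e_1+\alpha e_2,\ e_2\ast e_2=\frac12\beta e_1+(\alpha+\beta)e_2$. All these algebras are pairwise non-isomorphic, except $\mathcal{C}_{24}^{1,\beta,\gamma}\cong\mathcal{C}_{25}^{1,\beta,\gamma}$ for $\gamma\neq\beta$; $\mathcal{C}_{31}^{0,\beta,\gamma}\cong\mathcal{C}_{32}^{0,\beta,\gamma}$ for $\gamma\neq0$; $\mathcal{C}_{38}^{\alpha,\beta,\gamma}\cong\mathcal{C}_{38}^{\beta,\alpha,-\alpha+\beta+\gamma}$;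 $\mathcal{C}_{39}^{\alpha,\beta}\cong\mathcal{C}_{39}^{\beta,\alpha}$; $\mathcal{C}_{40}^{\alpha,\beta,\gamma}\cong\mathcal{C}_{40}^{4\gamma-\alpha,\ \beta-8\alpha+16\gamma,\ \gamma}$; $\mathcal{C}_{41}^{\alpha,\beta}\cong\mathcal{C}_{41}^{\alpha+4\beta,\ -\beta}$.
   Context: All algebras are over $\mathbb{C}$ and all maps are $\mathbb{C}$-linear. A pre-Lie algebra is a vector space with a bilinear multiplication $\cdot$ satisfying $(x\cdot y)\cdot z-x\cdot(y\cdot z)=(y\cdot x)\cdot z-y\cdot(x\cdot z)$. A compatible pre-Lie algebra is a vector space $\mathbf{A}$ with two bilinear multiplications $\cdot$ and $\ast$ such that $(\mathbf{A},\cdot)$, $(\mathbf{A},\ast)$ and $(\mathbf{A},\cdot+\ast)$ are pre-Lie algebras. It is nonzero if at least one of the two multiplications is nonzero. An isomorphism of compatible algebras is a linear bijection preserving both multiplications. In multiplication tables, products of basis elements whose value is zero are omitted.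
   Formalization: The printed list of exceptions omits C34^{α,β} ≅ C34^{α,−β}, an isomorphism given by e_1 ↦ e_1, e_2 ↦ −e_2 (so for β ≠ 0 the claim as printed fails); the formal statement adds this exception and changes nothing else. *)

(* Defs.v *)
From HB Require Import structures.
From mathcomp Require Import all_boot all_order all_algebra.
From mathcomp Require Import ring reals complex.

Set Implicit Arguments.
Unset Strict Implicit.
Unset Printing Implicit Defensive.

Import GRing.Theory.
Local Open Scope ring_scope.

Record two_mult_alg (F : fieldType) := TwoMultAlg {
  carrier :> vectType F;
  dot : {bilinear carrier -> carrier -> carrier};
  ast : {bilinear carrier -> carrier -> carrier}
}.
Arguments dot {F _}.
Arguments ast {F _}.

Definition pre_Lie (V : zmodType) (m : V -> V -> V) : Prop :=
  forall x y z : V,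
    m (m x y) z - m x (m y z) = m (m y x) z - m y (m x z).

Definition compatible_pre_Lie (F : fieldType) (A : two_mult_alg F) : Prop :=
  [/\ pre_Lie (@dot F A), pre_Lie (@ast F A)
    & pre_Lie (fun x y : A => dot x y + ast x y)].

Definition nonzero_alg (F : fieldType) (A : two_mult_alg F) : Prop :=
  (exists x y : A, dot x y != 0) \/ (exists x y : A, ast x y != 0).

Definition iso_alg (F : fieldType) (A B : two_mult_alg F) : Prop :=
  exists f : {linear A -> B},
    [/\ bijective f,
        forall x y : A, f (dot x y) = dot (f x) (f y)
      & forall x y : A, f (ast x y) = ast (f x) (f y)].

Section Tables.
Variable F : fieldType.

Definition e1 : 'rV[F]_2 := delta_mx 0 0.
Definition e2 : 'rV[F]_2 := delta_mx 0 1.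

(* The bilinear multiplication on F^2 whose products e1e1, e1e2, e2e1, e2e2
   are p11, p12, p21, p22, in this order. *)
Definition table_mul (p11 p12 p21 p22 : 'rV[F]_2) (x y : 'rV[F]_2)
    : 'rV[F]_2 :=
  (x 0 0 * y 0 0) *: p11 + (x 0 0 * y 0 1) *: p12 +
  (x 0 1 * y 0 0) *: p21 + (x 0 1 * y 0 1) *: p22.

Lemma table_mul_bilinear p11 p12 p21 p22 :
  bilinear_for *:%R *:%R (table_mul p11 p12 p21 p22).
Proof.
by split=> u a x y; apply/rowP=> j; rewrite /table_mul !mxE; ring.
Qed.

HB.instance Definition _ p11 p12 p21 p22 :=
  bilinear_isBilinear.Build F 'rV[F]_2 'rV[F]_2 'rV[F]_2 *:%R *:%R
    (table_mul p11 p12 p21 p22) (table_mul_bilinear p11 p12 p21 p22).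

Inductive label : Type :=
| C01 | C02 | C03 | C04
| C05 of F
| C06 of F
| C07 | C08
| C09 of F & F
| C10 of F & F
| C11 of F & F
| C12 of F & F
| C13 of F
| C14 of F
| C15 of F
| C16 of F
| C17 of F
| C18 of F
| C19 of F
| C20 of F & F
| C21 of F & F
| C22 of F & F
| C23 of F & F
| C24 of F & F & F
| C25 of F & F & F
| C26 of F
| C27 of F & F
| C28
| C29 of F
| C30 of F & F
| C31 of F & F & F
| C32 of F & F & F
| C33
| C34 of F & F
| C35 of F
| C36 of F & F
| C37 of F
| C38 of F & F & F
| C39 of F & F
| C40 of F & F & F
| C41 of F & F.

Definition admissible (l : label) : bool :=
  match l with
  | C09 a b => b != 0
  | C11 a b => b != a
  | C16 a => a != 1
  | C22 a b => a != 0
  | C23 a b => a != 0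
  | C39 a b => b != a
  | C41 a b => b != 0
  | _ => true
  end.

Local Notation M := table_mul.
Local Notation alg d s := (@TwoMultAlg F 'rV[F]_2 d s).
Local Notation half := (2^-1 : F).

(* Each line gives e1e1, e1e2, e2e1, e2e2 for the multiplication dot, then
   for the multiplication ast. *)
Definition calg (l : label) : two_mult_alg F :=
  match l with
  | C01 =>
      alg (M 0 0 0 0)
          (M (e1 + e2) 0 e2 0)
  | C02 =>
      alg (M 0 0 0 0)
          (M (e1 + e2) e2 0 0)
  | C03 =>
      alg (M 0 0 0 0)
          (M e2 0 0 0)
  | C04 =>
      alg (M 0 0 0 0)
          (M 0 0 e1 0)
  | C05 a =>
      alg (M 0 0 0 0)
          (M e1 (a *: e2) 0 0)
  | C06 a =>
      alg (M 0 0 0 0)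
          (M e1 (a *: e2) e2 0)
  | C07 =>
      alg (M 0 0 0 0)
          (M e1 0 0 e2)
  | C08 =>
      alg (M 0 0 0 0)
          (M e1 (2 *: e2) (half *: e1 + e2) e2)
  | C09 a b =>
      alg (M (e1 + e2) 0 e2 0)
          (M (a *: e1) (b *: e2) (a *: e2) 0)
  | C10 a b =>
      alg (M (e1 + e2) 0 e2 0)
          (M (a *: e1 + b *: e2) 0 (a *: e2) 0)
  | C11 a b =>
      alg (M (e1 + e2) e2 0 0)
          (M (a *: e1) (b *: e2) 0 0)
  | C12 a b =>
      alg (M (e1 + e2) e2 0 0)
          (M (a *: e1 + b *: e2) (a *: e2) 0 0)
  | C13 a =>
      alg (M e2 0 0 0)
          (M (a *: e1) e2 (a *: e2) 0)
  | C14 a =>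
      alg (M e2 0 0 0)
          (M (e1 + a *: e2) 0 e2 0)
  | C15 a =>
      alg (M e2 0 0 0)
          (M (a *: e2) 0 0 0)
  | C16 a =>
      alg (M e2 0 0 0)
          (M e1 (a *: e2) 0 0)
  | C17 a =>
      alg (M e2 0 0 0)
          (M (e1 + a *: e2) e2 0 0)
  | C18 a =>
      alg (M e2 0 0 0)
          (M (a *: e2) e1 e1 e2)
  | C19 a =>
      alg (M e2 0 0 0)
          (M (a *: e2) 0 e1 (2 *: e2))
  | C20 a b =>
      alg (M 0 0 e1 0)
          (M 0 0 (a *: e1) (e1 + b *: e2))
  | C21 a b =>
      alg (M 0 0 e1 0)
          (M 0 0 (a *: e1) (b *: e2))
  | C22 a b =>
      alg (M 0 0 e1 0)
          (M 0 (a *: e1) (b *: e1) (e1 + a *: e2))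
  | C23 a b =>
      alg (M 0 0 e1 0)
          (M 0 (a *: e1) (b *: e1) (a *: e2))
  | C24 a b g =>
      alg (M e1 (a *: e2) 0 0)
          (M (b *: e1 + e2) (g *: e2) 0 0)
  | C25 a b g =>
      alg (M e1 (a *: e2) 0 0)
          (M (b *: e1) (g *: e2) 0 0)
  | C26 a =>
      alg (M e1 (half *: e2) 0 0)
          (M ((2 * a) *: e1) (a *: e2) 0 e1)
  | C27 a b =>
      alg (M e1 (half *: e2) 0 0)
          (M ((2 * a) *: e1) (e1 + a *: e2) (2 *: e1) (b *: e1 + e2))
  | C28 =>
      alg (M e1 e2 0 0)
          (M 0 0 e1 e2)
  | C29 a =>
      alg (M e1 0 0 0)
          (M (a *: e1) 0 0 e2)
  | C30 a b =>
      alg (M e1 0 0 0)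
          (M (a *: e1 + b *: e2) e1 e1 e2)
  | C31 a b g =>
      alg (M e1 (a *: e2) e2 0)
          (M (b *: e1 + e2) (g *: e2) (b *: e2) 0)
  | C32 a b g =>
      alg (M e1 (a *: e2) e2 0)
          (M (b *: e1) (g *: e2) (b *: e2) 0)
  | C33 =>
      alg (M e1 0 e2 0)
          (M 0 e1 0 e2)
  | C34 a b =>
      alg (M e1 e2 e2 0)
          (M (a *: e1) (a *: e2) (a *: e2) (e1 + b *: e2))
  | C35 a =>
      alg (M e1 e2 e2 0)
          (M (a *: e1) (a *: e2) (a *: e2) e2)
  | C36 a b =>
      alg (M e1 (2 *: e2) e2 0)
          (M (a *: e1 + b *: e2) ((2 * a) *: e2) (e1 + a *: e2) (2 *: e2))
  | C37 a =>
      alg (M e1 (2 *: e2) e2 0)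
          (M (a *: e1) (e1 + (2 * a) *: e2) (2 *: e1 + a *: e2) e2)
  | C38 a b g =>
      alg (M e1 0 0 e2)
          (M ((g + b - a) *: e1 - b *: e2) (a *: e1 + b *: e2)
             (a *: e1 + b *: e2) ((- a) *: e1 + g *: e2))
  | C39 a b =>
      alg (M e1 0 0 e2)
          (M (a *: e1) 0 0 (b *: e2))
  | C40 a b g =>
      alg (M e1 (2 *: e2) (half *: e1 + e2) e2)
          (M (a *: e1 + b *: e2) ((2 * a) *: e2)
             (g *: e1 + a *: e2) ((2 * g) *: e2))
  | C41 a b =>
      alg (M e1 (2 *: e2) (half *: e1 + e2) e2)
          (M (a *: e1) (b *: e1 + (2 * a) *: e2)
             ((2 * b + half * a) *: e1 + a *: e2)
             ((half * b) *: e1 + (a + b) *: e2))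
  end.

(* The published list of exceptions omits exc34, but the change of basis
   (e1, e2) -> (e1, - e2) is an isomorphism from C34 a b to C34 a (- b). *)
Inductive exceptional : label -> label -> Prop :=
| exc24 b g of g != b : exceptional (C24 1 b g) (C25 1 b g)
| exc31 b g of g != 0 : exceptional (C31 0 b g) (C32 0 b g)
| exc34 a b : exceptional (C34 a b) (C34 a (- b))
| exc38 a b g : exceptional (C38 a b g) (C38 b a (- a + b + g))
| exc39 a b : exceptional (C39 a b) (C39 b a)
| exc40 a b g :
    exceptional (C40 a b g) (C40 (4 * g - a) (b - 8 * a + 16 * g) g)
| exc41 a b : exceptional (C41 a b) (C41 (a + 4 * b) (- b)).

(* No transitive closure is needed: every exception is either an involution
   of one family or pairs off members of two families in no other exception. *)
Definition same_class (l l' : label) : Prop :=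
  [\/ l = l', exceptional l l' | exceptional l' l].

End Tables.

Arguments C01 {F}.
Arguments C02 {F}.
Arguments C03 {F}.
Arguments C04 {F}.
Arguments C07 {F}.
Arguments C08 {F}.
Arguments C28 {F}.
Arguments C33 {F}.

(* Main.v *)
Require Import Defs.
From HB Require Import structures.
From mathcomp Require Import all_boot all_order all_algebra.
From mathcomp Require Import ring reals complex.
From Stdlib Require NsatzTactic.

(** In coordinates a compatible pre-Lie algebra is a pair of tables of eight
    structure constants, and everything becomes polynomial algebra.

    A single pre-Lie product is put in normal form as follows.  If it is
    commutative, it is associative, and unless it vanishes it is generated by
    one element [u]; the roots of the polynomial of [u] decide its class.
    Otherwise choose [u] and [w] with [u w - w u = w].  Left multiplication by
    [w] is then nilpotent, and the cases [w w <> 0], [w w = 0 <> w u] and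
    [w u = 0] give the noncommutative normal forms.

    Once a nonzero first product is in normal form, compatibility is a linear system
    for the second one; its solutions satisfying the quadratic pre-Lie
    equations are reduced by the automorphism group of the first product,
    which has dimension at most two.  The same automorphism groups decide
    which members of the list are isomorphic. *)

Set Implicit Arguments.
Unset Strict Implicit.
Unset Printing Implicit Defensive.

Import GRing.Theory Num.Theory.
Local Open Scope ring_scope.

(** * Groebner bases in fields of characteristic zero *)

Module FieldNsatz.
Import NsatzTactic.

Section Instances.
Variable F : numFieldType.

#[export] Instance field_ops :
  @Ring_ops F GRing.zero (GRing.one F) GRing.add GRing.mul
    (fun x y => GRing.add x (GRing.opp y)) GRing.opp eq := {}.

#[export] Instance field_ring : Ring (Ro := field_ops).
Proof.
split; rewrite /equality /eq_notation /addition /multiplication /=.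
all: rewrite /add_notation /mul_notation /sub_notation /opp_notation.
all: rewrite /zero_notation /one_notation /=.
all: try by [move=> ? ? -> ? ? ->|move=> ? ? ->].
all: try by [exact: eq_equivalence|exact: add0r|exact: addrC|exact: addrA
  |exact: mul1r|exact: mulr1|exact: mulrA|exact: mulrDl|exact: subrr
  |move=> *; exact: mulrDr|by []].
Qed.

#[export] Instance field_cring : Cring (Rr := field_ring).
Proof. exact: mulrC. Qed.

#[export] Instance field_domain : Integral_domain (Rcr := field_cring).
Proof.
split=> [x y /eqP|/eqP]; last by apply/negP; exact: oner_neq0.
by rewrite mulf_eq0 => /orP[]/eqP->; [left|right].
Qed.

Lemma IPR_gt0 p : (0 < (IPR p : F))%R.
Proof.
elim: p => [p IH|p IH|] /=; last exact: ltr01.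
- by case: p IH => [p|p|] IH; rewrite ?addr_gt0 ?mulr_gt0 ?addr_gt0 ?ltr01.
- by case: p IH => [p|p|] IH; rewrite ?mulr_gt0 ?addr_gt0 ?ltr01.
Qed.

(** [nsatz] shows that a nonzero integer multiple of a power of the goal vanishes. Characteristic
    zero, here positivity of numerals, allows that integer to be cancelled. *)
Lemma interp_const_neq0 (l : list F) z : z <> BinNums.Z0 ->
  interpret3 (Ring_polynom.PEc z) l <> GRing.zero.
Proof.
case: z => [//|p|p] _ /=; first by apply/eqP; exact: lt0r_neq0 (IPR_gt0 p).
by apply/eqP; rewrite oppr_eq0; exact: lt0r_neq0 (IPR_gt0 p).
Qed.
End Instances.

#[export] Hint Extern 0 (~ equality (interpret3 _ _) _) =>
  (apply: interp_const_neq0; discriminate) : core.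

Ltac reified_goal l es :=
  lazymatch es with
  | cons ?e1 (cons ?e2 nil) => constr:(interpret3 e1 l == interpret3 e2 l)
  | cons ?e1 (cons ?e2 ?es') =>
      let g := reified_goal l es' in
      constr:(interpret3 e1 l == interpret3 e2 l -> g)
  end.

(* One conversion for the whole goal is much faster than the library's
   rewriting of each side of each equation. *)
Ltac reify_goal l es _ ::= let g := reified_goal l es in change g.

Ltac nsatz_eq := nsatz.
End FieldNsatz.
Import FieldNsatz.

Lemma nonzero_inv (F : numFieldType) (x : F) : x != 0 -> exists w, x * w = 1.
Proof. by move=> nz; exists x^-1; rewrite mulfV. Qed.

Lemma invr_exists (F : numFieldType) (a b : F) :
  a != b -> exists w, (a - b) * w = 1.
Proof. by rewrite -subr_eq0 => /nonzero_inv. Qed.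

(** Turns a goal [False] into an equation that [nsatz] can attack; [x] tells it the field. *)
Lemma one_eq0 (F : numFieldType) (x : F) : (1 : F) = 0 -> False.
Proof. by move/eqP; rewrite oner_eq0. Qed.

Lemma half_double (F : numFieldType) : (2^-1 : F) * 2 = 1.
Proof. by rewrite mulVf // pnatr_eq0. Qed.

(* [nsatz] stops collecting hypotheses at the first one that is a relation
   other than an equation in the field. *)
Ltac keep_field_eqs :=
  lazymatch goal with |- @eq ?F _ _ =>
    repeat match goal with
    | H : ?P |- _ =>
        lazymatch type of P with Prop =>
          lazymatch P with
          | @eq ?T _ _ => tryif unify T F then fail else clear H
          | _ => clear H
          end
        end
    end
  end.

(* A hypothesis [a != b] is turned into an inverse of [a - b], [1 / 2] into a
   variable, and numerals into sums: [nsatz] sees polynomial equations only. *)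
Ltac fsatz :=
  intros;
  try match goal with
  | |- is_true (_ != _) => apply/eqP; intro
  | |- _ <> _ => intro
  end;
  try match goal with
  | x : _ |- False => apply: (one_eq0 x)
  end;
  repeat match goal with
  | H : is_true (?a != ?b) |- _ =>
      let w := fresh "w" in let E := fresh "E" in
      have [w E] := invr_exists H; clear H
  end;
  repeat (let h := fresh "h" in let hE := fresh "hE" in
    let u := match goal with
      | _ : context [@GRing.inv ?R (?x *+ 2)] |- _ =>
          constr:(@GRing.inv R (x *+ 2))
      | |- context [@GRing.inv ?R (?x *+ 2)] => constr:(@GRing.inv R (x *+ 2))
      end in
    have hE : u * 2 = 1 by [exact: half_double];
    set (h := u) in *; clearbody h);
  repeat match goal with
  | H : context [?x *+ ?n.+2] |- _ =>
      change (x *+ n.+2) with (x + x *+ n.+1) in H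
  | |- context [?x *+ ?n.+2] => change (x *+ n.+2) with (x + x *+ n.+1)
  end;
  repeat match goal with
  | H : context [?x *+ 1] |- _ => change (x *+ 1) with x in H
  | |- context [?x *+ 1] => change (x *+ 1) with x
  end;
  keep_field_eqs; nsatz_eq.

(** * Algebras in coordinates *)

Section Isomorphism.
Variable F : fieldType.
Implicit Types A B C : two_mult_alg F.

Lemma iso_alg_refl A : iso_alg A A.
Proof. by exists idfun; split=> //; exists idfun. Qed.

Lemma iso_alg_sym A B : iso_alg A B -> iso_alg B A.
Proof.
case=> f [bij_f fdot fast]; case: (bij_f) => g fK gK.
have lin_g : linear g.
  by move=> a u v; apply: (bij_inj bij_f); rewrite gK linearP !gK.
pose G : {linear B -> A} := HB.pack g (GRing.isLinear.Build _ _ _ _ g lin_g).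
exists G; split=> [|x y|x y]; first by exists f.
- by apply: (bij_inj bij_f); rewrite fdot /= !gK.
- by apply: (bij_inj bij_f); rewrite fast /= !gK.
Qed.

Lemma iso_alg_trans A B C : iso_alg A B -> iso_alg B C -> iso_alg A C.
Proof.
move=> [f [bij_f fdot fast]] [g [bij_g gdot gast]].
exists (g \o f); split=> [|x y|x y] /=; first exact: bij_comp.
- by rewrite fdot gdot.
- by rewrite fast gast.
Qed.

Lemma iso_compatible A B :
  iso_alg A B -> compatible_pre_Lie B -> compatible_pre_Lie A.
Proof.
case=> f [/bij_inj f_inj fdot fast] [Bdot Bast Bsum].
split=> x y z; apply: f_inj.
- by have := Bdot (f x) (f y) (f z); rewrite -!fdot -!linearB.
- by have := Bast (f x) (f y) (f z); rewrite -!fast -!linearB.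
- have := Bsum (f x) (f y) (f z).
  by do 4!rewrite -?fdot -?fast -?linearD /=; rewrite -!linearB.
Qed.

Lemma iso_nonzero A B : iso_alg A B -> nonzero_alg A -> nonzero_alg B.
Proof.
case=> f [/bij_inj f_inj fdot fast] [][x [y nz]]; [left|right];
  exists (f x), (f y); rewrite -?fdot -?fast; apply: contra_neq nz => f0;
  by apply: f_inj; rewrite f0 linear0.
Qed.
End Isomorphism.

Section Coordinates.
Variable F : fieldType.

(* The multiplication with [e_i e_j = aij e1 + bij e2]. *)
Record tab := Tab {
  a11 : F; b11 : F; a12 : F; b12 : F;
  a21 : F; b21 : F; a22 : F; b22 : F
}.

Definition row2 (a b : F) : 'rV[F]_2 := a *: e1 F + b *: e2 F.

Definition mult (t : tab) : 'rV[F]_2 -> 'rV[F]_2 -> 'rV[F]_2 :=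
  table_mul (row2 (a11 t) (b11 t)) (row2 (a12 t) (b12 t))
            (row2 (a21 t) (b21 t)) (row2 (a22 t) (b22 t)).

Definition talg (d s : tab) : two_mult_alg F :=
  @TwoMultAlg F 'rV[F]_2
    (table_mul (row2 (a11 d) (b11 d)) (row2 (a12 d) (b12 d))
               (row2 (a21 d) (b21 d)) (row2 (a22 d) (b22 d)))
    (table_mul (row2 (a11 s) (b11 s)) (row2 (a12 s) (b12 s))
               (row2 (a21 s) (b21 s)) (row2 (a22 s) (b22 s))).

Lemma row2_0 a b : row2 a b 0 0 = a.
Proof. by rewrite !mxE /= mulr1 mulr0 addr0. Qed.

Lemma row2_1 a b : row2 a b 0 1 = b.
Proof. by rewrite !mxE /= mulr1 mulr0 add0r. Qed.

Lemma row2P (x y : 'rV[F]_2) : x 0 0 = y 0 0 -> x 0 1 = y 0 1 -> x = y.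
Proof.
move=> x0 x1; apply/rowP=> j; case: j => [[|[|//]] j2].
- by have -> : Ordinal j2 = 0 by apply: val_inj.
- by have -> : Ordinal j2 = 1 by apply: val_inj.
Qed.

Lemma row2_eta (x : 'rV[F]_2) : row2 (x 0 0) (x 0 1) = x.
Proof. by apply: row2P; rewrite ?row2_0 ?row2_1. Qed.

Definition mult1 (t : tab) (x1 x2 y1 y2 : F) : F :=
  x1 * y1 * a11 t + x1 * y2 * a12 t + x2 * y1 * a21 t + x2 * y2 * a22 t.

Definition mult2 (t : tab) (x1 x2 y1 y2 : F) : F :=
  x1 * y1 * b11 t + x1 * y2 * b12 t + x2 * y1 * b21 t + x2 * y2 * b22 t.

Lemma multE t x1 x2 y1 y2 :
  mult t (row2 x1 x2) (row2 y1 y2) =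
  row2 (mult1 t x1 x2 y1 y2) (mult2 t x1 x2 y1 y2).
Proof.
by apply: row2P; rewrite ?(row2_0, row2_1) /mult /table_mul /mult1 /mult2;
  rewrite /row2 !mxE /=; ring.
Qed.

(* [row2 p q] and [row2 r s] are the images of [e1] and [e2]. *)
Definition tab_hom (p q r s : F) (t u : tab) : Prop :=
  (a11 t * p + b11 t * r = mult1 u p q p q /\
   a11 t * q + b11 t * s = mult2 u p q p q) /\
  (a12 t * p + b12 t * r = mult1 u p q r s /\
   a12 t * q + b12 t * s = mult2 u p q r s) /\
  (a21 t * p + b21 t * r = mult1 u r s p q /\
   a21 t * q + b21 t * s = mult2 u r s p q) /\
  (a22 t * p + b22 t * r = mult1 u r s r s /\
   a22 t * q + b22 t * s = mult2 u r s r s).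

Definition mx2 (p q r s : F) : 'M[F]_2 :=
  \matrix_(i, j) if i == 0 then (if j == 0 then p else q)
                 else (if j == 0 then r else s).

Lemma row2_mx2 p q r s a b :
  row2 a b *m mx2 p q r s = row2 (a * p + b * r) (a * q + b * s).
Proof.
by apply: row2P; rewrite ?row2_0 ?row2_1 mxE !big_ord_recl big_ord0 addr0;
  rewrite /row2 !mxE /=; ring.
Qed.

Lemma talg_isoP d1 s1 d2 s2 :
  iso_alg (talg d1 s1) (talg d2 s2) <->
  exists p q r s : F, [/\ p * s - q * r != 0, tab_hom p q r s d1 d2
                    & tab_hom p q r s s1 s2].
Proof.
split=> [[f [/bij_inj f_inj fdot fast]]|[p [q [r [s [nz hd hs]]]]]].
  pose p : F := (f (e1 F) : 'rV_2) 0 0; pose q : F := (f (e1 F) : 'rV_2) 0 1.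
  pose r : F := (f (e2 F) : 'rV_2) 0 0; pose s : F := (f (e2 F) : 'rV_2) 0 1.
  have fE a b : f (row2 a b) = row2 (a * p + b * r) (a * q + b * s).
    rewrite linearP linearZ /= -[f (e1 F)]row2_eta -[f (e2 F)]row2_eta.
    rewrite -/p -/q -/r -/s.
    by apply: row2P; rewrite ?row2_0 ?row2_1 /row2 !mxE /=; ring.
  have mulP t u : (forall x y, f (mult t x y) = mult u (f x) (f y)) ->
    tab_hom p q r s t u.
    move=> H; have e a b c d :
      row2 (mult1 t a b c d * p + mult2 t a b c d * r)
           (mult1 t a b c d * q + mult2 t a b c d * s) =
      row2 (mult1 u (a * p + b * r) (a * q + b * s)
                    (c * p + d * r) (c * q + d * s))
           (mult2 u (a * p + b * r) (a * q + b * s)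
                    (c * p + d * r) (c * q + d * s)).
      by rewrite -fE -!multE H !fE.
    have e_0 a b c d := congr1 (fun x : 'rV_2 => x 0 0) (e a b c d).
    have e_1 a b c d := congr1 (fun x : 'rV_2 => x 0 1) (e a b c d).
    move: e_0 e_1 => /= e_0 e_1.
    have := (e_0 1 0 1 0, e_0 1 0 0 1, e_0 0 1 1 0, e_0 0 1 0 1).
    have := (e_1 1 0 1 0, e_1 1 0 0 1, e_1 0 1 1 0, e_1 0 1 0 1).
    rewrite !row2_0 !row2_1 /tab_hom /mult1 /mult2.
    rewrite !(mul0r, mulr0, mul1r, mulr1, add0r, addr0).
    by move=> [[[-> ->] ->] ->] [[[-> ->] ->] ->].
  exists p, q, r, s; split; [|exact: mulP fdot|exact: mulP fast].
  apply/eqP=> det0.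
  have f0 a b : a * p + b * r = 0 -> a * q + b * s = 0 -> a = 0 /\ b = 0.
    move=> E0 E1; have : row2 a b = row2 0 0.
      by apply: f_inj; rewrite !fE E0 E1 !mul0r addr0.
    move=> E; split; first by rewrite -(row2_0 a b) E row2_0.
    by rewrite -(row2_1 a b) E row2_1.
  (* With zero determinant, [row2 s (- q)] and then [row2 r (- p)] lie in the kernel; injectivity
     makes the whole matrix vanish, and then [e1] is in the kernel too. *)
  have [] := f0 s (- q) _ _; try by [rewrite -det0; ring|ring].
  move=> s0 /eqP; rewrite oppr_eq0 => /eqP q0.
  have [] := f0 r (- p) _ _; [by ring|by rewrite s0 q0 !mulr0 addr0|].
  move=> r0 /eqP; rewrite oppr_eq0 => /eqP p0.
  have [] := f0 1 0; rewrite ?p0 ?q0 ?mulr0 ?mul0r ?addr0 //.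
  by move/eqP; rewrite oner_eq0.
pose f := mulmxr (mx2 p q r s) : {linear 'rV[F]_2 -> 'rV[F]_2}.
have fE a b : f (row2 a b) = row2 (a * p + b * r) (a * q + b * s).
  exact: row2_mx2.
have mulP t u : tab_hom p q r s t u ->
  forall x y, f (mult t x y) = mult u (f x) (f y).
  case=> [[h1 h2] [[h3 h4] [[h5 h6] [h7 h8]]]] x y.
  rewrite -(row2_eta x) -(row2_eta y) multE !fE multE.
  set x0 := x 0 0; set x1 := x 0 1; set y0 := y 0 0; set y1 := y 0 1.
  congr row2.
    transitivity (x0 * y0 * (a11 t * p + b11 t * r) +
      x0 * y1 * (a12 t * p + b12 t * r) + x1 * y0 * (a21 t * p + b21 t * r) +
      x1 * y1 * (a22 t * p + b22 t * r)); first by rewrite /mult1 /mult2; ring.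
    by rewrite h1 h3 h5 h7 /mult1; ring.
  transitivity (x0 * y0 * (a11 t * q + b11 t * s) +
    x0 * y1 * (a12 t * q + b12 t * s) + x1 * y0 * (a21 t * q + b21 t * s) +
    x1 * y1 * (a22 t * q + b22 t * s)); first by rewrite /mult1 /mult2; ring.
  by rewrite h2 h4 h6 h8 /mult2; ring.
exists f; split; [|exact: mulP|exact: mulP].
pose g := mulmxr (mx2 (s / (p * s - q * r)) (- q / (p * s - q * r))
                      (- r / (p * s - q * r)) (p / (p * s - q * r)))
  : 'rV[F]_2 -> 'rV[F]_2.
exists g => x; rewrite -(row2_eta x) /f /g /= !row2_mx2; congr row2; by field.
Qed.

(** The pre-Lie identity is trilinear and alternating in [x], [y], so it suffices to take [x = e1],
    [y = e2]. The equations are its two coordinates for [z = e1], then for [z = e2]. *)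
Definition preLie_tab (t : tab) : Prop :=
  let: Tab a11 b11 a12 b12 a21 b21 a22 b22 := t in
  [/\ a11 * a12 - a11 * a21 - a12 * b21 + a21 * b12 - a21 * b21 + a22 * b11 = 0,
      a11 * b21 + a12 * b11 - 2 * a21 * b11 + b11 * b22 - b21 * b21 = 0,
      a12 * a12 - a11 * a22 - a12 * b22 + 2 * a22 * b12 - a22 * b21 = 0
    & a12 * b12 + a12 * b21 - a21 * b12 - a22 * b11 + b12 * b22 - b21 * b22
      = 0].

Lemma preLieP t : pre_Lie (mult t) <-> preLie_tab t.
Proof.
case: t => A11 B11 A12 B12 A21 B21 A22 B22; set t := Tab _ _ _ _ _ _ _ _.
have subE (a b c d : F) : row2 a b - row2 c d = row2 (a - c) (b - d).
  by apply: row2P; rewrite /row2 !mxE /=; ring.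
split=> [H|[h1 h2 h3 h4] x y z].
  have e c d := H (row2 1 0) (row2 0 1) (row2 c d).
  have e_0 c d := congr1 (fun x : 'rV_2 => x 0 0) (e c d).
  have e_1 c d := congr1 (fun x : 'rV_2 => x 0 1) (e c d).
  move: e_0 e_1 => /= e_0 e_1.
  have := (e_0 1 0, e_1 1 0, e_0 0 1, e_1 0 1).
  rewrite !(multE, subE, row2_0, row2_1) /mult1 /mult2 /=.
  rewrite !(mul0r, mulr0, mul1r, mulr1, add0r, addr0).
  move=> [[[h1 h2] h3] h4].
  have eq0 (a b c : F) : a = b -> c = a - b -> c = 0.
    by move=> -> ->; rewrite subrr.
  split;
    [apply: eq0 h1 _|apply: eq0 h2 _|apply: eq0 h3 _|apply: eq0 h4 _]; ring.
rewrite -(row2_eta x) -(row2_eta y) -(row2_eta z) !multE !subE /mult1 /mult2 /=.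
set x0 := x 0 0; set x1 := x 0 1; set y0 := y 0 0; set y1 := y 0 1.
set z0 := z 0 0; set z1 := z 0 1.
congr row2; apply/eqP; rewrite -subr_eq0; apply/eqP.
(* The two zeros are placeholders, rewritten backwards into the left sides of the equations for
   [z = e1] and [z = e2]. *)
- transitivity ((x0 * y1 - x1 * y0) * (z0 * 0 + z1 * 0)); last by ring.
  by rewrite -{1}h1 -h3; ring.
- transitivity ((x0 * y1 - x1 * y0) * (z0 * 0 + z1 * 0)); last by ring.
  by rewrite -{1}h2 -h4; ring.
Qed.

Definition tabD (t u : tab) : tab :=
  Tab (a11 t + a11 u) (b11 t + b11 u) (a12 t + a12 u) (b12 t + b12 u)
      (a21 t + a21 u) (b21 t + b21 u) (a22 t + a22 u) (b22 t + b22 u).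

Lemma multD t u x y : mult (tabD t u) x y = mult t x y + mult u x y.
Proof.
by apply: row2P; rewrite /mult /table_mul /row2 !mxE /=; ring.
Qed.

Lemma talg_compatibleP d s :
  compatible_pre_Lie (talg d s) <->
  [/\ preLie_tab d, preLie_tab s & preLie_tab (tabD d s)].
Proof.
split=> [[/preLieP hd /preLieP hs hds]|[/preLieP hd /preLieP hs /preLieP hds]].
  by split=> //; apply/preLieP=> x y z; rewrite !multD; apply: hds.
by split=> // x y z; have := hds x y z; rewrite !multD; apply.
Qed.

Lemma dim_talg d s : \dim {: talg d s} = 2%N.
Proof. by rewrite dimvf /dim /= mul1n. Qed.

Definition tab0 : tab := Tab 0 0 0 0 0 0 0 0.

Lemma mult_eq0 t : (forall x y, mult t x y = 0) -> t = tab0.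
Proof.
move=> H; have e a b c d : row2 (mult1 t a b c d) (mult2 t a b c d) = row2 0 0.
  by rewrite -multE H; apply: row2P; rewrite /row2 !mxE /=; ring.
have e_0 a b c d := congr1 (fun x : 'rV_2 => x 0 0) (e a b c d).
have e_1 a b c d := congr1 (fun x : 'rV_2 => x 0 1) (e a b c d).
move: e_0 e_1 => /= e_0 e_1.
have := (e_0 1 0 1 0, e_0 1 0 0 1, e_0 0 1 1 0, e_0 0 1 0 1).
have := (e_1 1 0 1 0, e_1 1 0 0 1, e_1 0 1 1 0, e_1 0 1 0 1).
rewrite !row2_0 !row2_1 /mult1 /mult2.
rewrite !(mul0r, mulr0, mul1r, mulr1, add0r, addr0).
case: t {H e e_0 e_1} => ? ? ? ? ? ? ? ? /=.
by move=> [[[-> ->] ->] ->] [[[-> ->] ->] ->].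
Qed.

Lemma talg_nonzeroP d s : nonzero_alg (talg d s) <-> d <> tab0 \/ s <> tab0.
Proof.
have nzP t : (exists x y, mult t x y != 0) <-> t <> tab0.
  split=> [[x [y /eqP nz]] t0|nz].
    by apply: nz; rewrite t0 -(row2_eta x) -(row2_eta y) multE;
      apply: row2P; rewrite /row2 /mult1 /mult2 !mxE /=; ring.
  apply: boolp.contrapT => H; apply: nz; apply: mult_eq0 => x y.
  by apply/eqP/negPn/negP => nz; apply: H; exists x, y.
by rewrite /nonzero_alg; split; case=> [/nzP|/nzP]; auto.
Qed.

Lemma iso_talg_exists (A : two_mult_alg F) : \dim {: A} = 2%N ->
  exists d s, iso_alg A (talg d s).
Proof.
move=> dimA.
have [X bX] : exists X : 2.-tuple A, basis_of fullv X.
  by rewrite -dimA; exists (vbasis fullv); apply: vbasisP.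
have [f [g fK gK]] : exists f : {linear A -> 'rV[F]_2}, bijective f.
  pose h (x : A) := row2 (coord X 0 x) (coord X 1 x).
  have lin_h : linear h.
    by move=> a x y; apply: row2P; rewrite /h /row2 !linearP !mxE /=; ring.
  pose H : {linear A -> 'rV[F]_2} :=
    HB.pack h (GRing.isLinear.Build _ _ _ _ h lin_h).
  exists H; exists (fun x : 'rV[F]_2 => x 0 0 *: X`_0 + x 0 1 *: X`_1) => x.
    rewrite /= /h row2_0 row2_1 [RHS](coord_basis bX (memvf x)).
    rewrite !big_ord_recl big_ord0 addr0 /=.
    by congr (_ + coord X _ x *: _); apply: val_inj.
  have c0 j : coord X j X`_0 = (0 == j)%:R.
    exact: (@coord_free _ _ _ X 0 j (basis_free bX)).
  have c1 j : coord X j X`_1 = (1 == j)%:R.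
    exact: (@coord_free _ _ _ X 1 j (basis_free bX)).
  rewrite /= /h !linearD !linearZ /= !c0 !c1 /=.
  by apply: row2P; rewrite ?row2_0 ?row2_1 /=; ring.
pose u := g (e1 F); pose v := g (e2 F).
have f_inj := can_inj fK.
have gE a b : g (row2 a b) = a *: u + b *: v.
  by apply: f_inj; rewrite linearD !linearZ !gK.
pose tabl (m : A -> A -> A) := Tab
  (f (m u u) 0 0) (f (m u u) 0 1) (f (m u v) 0 0) (f (m u v) 0 1)
  (f (m v u) 0 0) (f (m v u) 0 1) (f (m v v) 0 0) (f (m v v) 0 1).
exists (tabl (@dot F A)), (tabl (@ast F A)).
have fM (m : {bilinear A -> A -> A}) x y :
    f (m x y) = mult (tabl m) (f x) (f y).
  rewrite -{1}(fK x) -{1}(fK y) -(row2_eta (f x)) -(row2_eta (f y)) !gE.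
  rewrite linearDl !linearDr !linearZl_LR !linearZr_LR /=.
  rewrite multE /mult1 /mult2.
  by apply: row2P; rewrite ?(row2_0, row2_1) !linearD !linearZ !mxE /=; ring.
exists f; split; [by exists g|exact: fM|exact: fM].
Qed.

End Coordinates.

(** * The list in coordinates *)

Section Labels.
Variable F : fieldType.
Local Notation half := (2^-1 : F).

(* Normal forms of a single pre-Lie multiplication; the nonzero ones are the
   second multiplications of [C01] to [C08]. *)
Inductive mlabel : Type :=
| D0 | D1 | D2 | D3 | D4 | D5 of F | D6 of F | D7 | D8.

Definition mtab (k : mlabel) : tab F :=
  match k with
  | D0 => tab0 F
  | D1 => Tab 1 1 0 0 0 1 0 0
  | D2 => Tab 1 1 0 1 0 0 0 0
  | D3 => Tab 0 1 0 0 0 0 0 0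
  | D4 => Tab 0 0 0 0 1 0 0 0
  | D5 a => Tab 1 0 0 a 0 0 0 0
  | D6 a => Tab 1 0 0 a 0 1 0 0
  | D7 => Tab 1 0 0 0 0 0 0 1
  | D8 => Tab 1 0 0 2 half 1 0 1
  end.

(** Grouping the list by first product lets both existence and uniqueness fix that product and work
    with its automorphisms. *)
Definition dot_of (l : label F) : mlabel :=
  match l with
  | C09 _ _ | C10 _ _ => D1
  | C11 _ _ | C12 _ _ => D2
  | C13 _ | C14 _ | C15 _ | C16 _ | C17 _ | C18 _ | C19 _ => D3
  | C20 _ _ | C21 _ _ | C22 _ _ | C23 _ _ => D4
  | C24 a _ _ | C25 a _ _ => D5 a
  | C26 _ | C27 _ _ => D5 half
  | C28 => D5 1
  | C29 _ | C30 _ _ => D5 0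
  | C31 a _ _ | C32 a _ _ => D6 a
  | C33 => D6 0
  | C34 _ _ | C35 _ => D6 1
  | C36 _ _ | C37 _ => D6 2
  | C38 _ _ _ | C39 _ _ => D7
  | C40 _ _ _ | C41 _ _ => D8
  | _ => D0
  end.

Definition ast_of (l : label F) : tab F :=
  match l with
  | C01 => mtab D1
  | C02 => mtab D2
  | C03 => mtab D3
  | C04 => mtab D4
  | C05 a => mtab (D5 a)
  | C06 a => mtab (D6 a)
  | C07 => mtab D7
  | C08 => mtab D8
  | C09 a b => Tab a 0 0 b 0 a 0 0
  | C10 a b => Tab a b 0 0 0 a 0 0
  | C11 a b => Tab a 0 0 b 0 0 0 0
  | C12 a b => Tab a b 0 a 0 0 0 0
  | C13 a => Tab a 0 0 1 0 a 0 0
  | C14 a => Tab 1 a 0 0 0 1 0 0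
  | C15 a => Tab 0 a 0 0 0 0 0 0
  | C16 a => Tab 1 0 0 a 0 0 0 0
  | C17 a => Tab 1 a 0 1 0 0 0 0
  | C18 a => Tab 0 a 1 0 1 0 0 1
  | C19 a => Tab 0 a 0 0 1 0 0 2
  | C20 a b => Tab 0 0 0 0 a 0 1 b
  | C21 a b => Tab 0 0 0 0 a 0 0 b
  | C22 a b => Tab 0 0 a 0 b 0 1 a
  | C23 a b => Tab 0 0 a 0 b 0 0 a
  | C24 a b g => Tab b 1 0 g 0 0 0 0
  | C25 a b g => Tab b 0 0 g 0 0 0 0
  | C26 a => Tab (2 * a) 0 0 a 0 0 1 0
  | C27 a b => Tab (2 * a) 0 1 a 2 0 b 1
  | C28 => Tab 0 0 0 0 1 0 0 1
  | C29 a => Tab a 0 0 0 0 0 0 1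
  | C30 a b => Tab a b 1 0 1 0 0 1
  | C31 a b g => Tab b 1 0 g 0 b 0 0
  | C32 a b g => Tab b 0 0 g 0 b 0 0
  | C33 => Tab 0 0 1 0 0 0 0 1
  | C34 a b => Tab a 0 0 a 0 a 1 b
  | C35 a => Tab a 0 0 a 0 a 0 1
  | C36 a b => Tab a b 0 (2 * a) 1 a 0 2
  | C37 a => Tab a 0 1 (2 * a) 2 a 0 1
  | C38 a b g => Tab (g + b - a) (- b) a b a b (- a) g
  | C39 a b => Tab a 0 0 0 0 0 0 b
  | C40 a b g => Tab a b 0 (2 * a) g a 0 (2 * g)
  | C41 a b => Tab a 0 b (2 * a) (2 * b + half * a) a (half * b) (a + b)
  end.

Lemma calgE l : calg l = talg (mtab (dot_of l)) (ast_of l).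
Proof.
case: l => * /=; rewrite /talg /row2 /= ?scale0r ?scale1r ?addr0 ?add0r //.
by rewrite !scaleNr.
Qed.
End Labels.

Arguments D0 {F}.
Arguments D1 {F}.
Arguments D2 {F}.
Arguments D3 {F}.
Arguments D4 {F}.
Arguments D7 {F}.
Arguments D8 {F}.

(** * Every label gives a nonzero compatible pre-Lie algebra *)

Section Compat.
Variable F : numFieldType.

Lemma calg_compatible (l : label F) : compatible_pre_Lie (calg l).
Proof.
rewrite calgE talg_compatibleP.
by case: l => * /=; do !split; first [ring | field].
Qed.

Lemma calg_nonzero (l : label F) : nonzero_alg (calg l).
Proof.
rewrite calgE talg_nonzeroP.
(* The first entry that is not literally zero, in [dot] or, when [dot] vanishes, in [ast], is
   [1]. *)
by case: l => * /=;
  first [left=> -[] /eqP; rewrite oner_eq0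
        |right=> -[] /eqP; rewrite oner_eq0].
Qed.
End Compat.

(** * Isomorphisms between members of the list *)

Ltac tab_homs := rewrite /tab_hom /mult1 /mult2 /=; do !split; fsatz.

Ltac hom_eqs H :=
  rewrite /tab_hom /mult1 /mult2 /= in H;
  let h1 := fresh "h" in let h2 := fresh "h" in let h3 := fresh "h" in
  let h4 := fresh "h" in let h5 := fresh "h" in let h6 := fresh "h" in
  let h7 := fresh "h" in let h8 := fresh "h" in
  destruct H as [[h1 h2] [[h3 h4] [[h5 h6] [h7 h8]]]].

Section Uniqueness.
Variable F : numFieldType.

Lemma mtab_inj (p q r s : F) k l :
  p * s - q * r != 0 -> tab_hom p q r s (mtab k) (mtab l) -> k = l.
Proof.
case: k l => [|||||a|a||] [|||||b|b||] // det H; hom_eqs H.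
all: try by [congr D5; fsatz|congr D6; fsatz].
all: by exfalso; fsatz.
Qed.

(** For [D1] and [D2] only the shears [e1 -> e1 + q e2] remain. *)
Lemma aut_D1 (p q r s : F) : p * s - q * r != 0 ->
  tab_hom p q r s (mtab D1) (mtab D1) -> [/\ p = 1, r = 0 & s = 1].
Proof. by move=> det H; hom_eqs H; split; fsatz. Qed.

Lemma aut_D2 (p q r s : F) : p * s - q * r != 0 ->
  tab_hom p q r s (mtab D2) (mtab D2) -> [/\ p = 1, r = 0 & s = 1].
Proof. by move=> det H; hom_eqs H; split; fsatz. Qed.

Lemma aut_D3 (p q r s : F) : p * s - q * r != 0 ->
  tab_hom p q r s (mtab D3) (mtab D3) -> r = 0 /\ s = p * p.
Proof. by move=> det H; hom_eqs H; split; fsatz. Qed.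

Lemma aut_D4 (p q r s : F) : p * s - q * r != 0 ->
  tab_hom p q r s (mtab D4) (mtab D4) -> [/\ q = 0, r = 0 & s = 1].
Proof. by move=> det H; hom_eqs H; split; fsatz. Qed.

(** Shearing [e1] along [e2] is possible only for [a = 1]; this is the source of [exc24]. In the
    same way [D6] allows it only for [a = 0], the source of [exc31]. *)
Lemma aut_D5 (a p q r s : F) : p * s - q * r != 0 ->
  tab_hom p q r s (mtab (D5 a)) (mtab (D5 a)) ->
  [/\ p = 1, r = 0 & q * (a - 1) = 0].
Proof. by move=> det H; hom_eqs H; split; fsatz. Qed.

Lemma aut_D6 (a p q r s : F) : p * s - q * r != 0 ->
  tab_hom p q r s (mtab (D6 a)) (mtab (D6 a)) ->
  [/\ p = 1, r = 0 & q * a = 0].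
Proof. by move=> det H; hom_eqs H; split; fsatz. Qed.

(** The swap of the two idempotents is the source of [exc38] and [exc39]. *)
Lemma aut_D7 (p q r s : F) : p * s - q * r != 0 ->
  tab_hom p q r s (mtab D7) (mtab D7) ->
  [/\ p = 1, q = 0, r = 0 & s = 1] \/
  [/\ p = 0, q = 1, r = 1 & s = 0].
Proof.
move=> det H; hom_eqs H.
have /eqP : p * (p - 1) = 0 by fsatz.
by rewrite mulf_eq0 subr_eq0 => /orP[]/eqP Hp; [right|left]; split; fsatz.
Qed.

(** The involution [e1 -> - e1 + 4 e2], [e2 -> e2] is the source of [exc40] and [exc41]. *)
Lemma aut_D8 (p q r s : F) : p * s - q * r != 0 ->
  tab_hom p q r s (mtab D8) (mtab D8) ->
  [/\ p = 1, q = 0, r = 0 & s = 1] \/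
  [/\ p = - 1, q = 4, r = 0 & s = 1].
Proof.
move=> det H; hom_eqs H.
have /eqP : (p - 1) * (p + 1) = 0 by fsatz.
rewrite mulf_eq0 subr_eq0 addr_eq0 => /orP[]/eqP Hp; [left|right].
  by split; fsatz.
by split; fsatz.
Qed.
End Uniqueness.

Ltac same_label :=
  constructor 1; match goal with |- ?c = _ => f_equal; fsatz end.

(** * Labels sharing a first product *)

Section LabelUniqueness.
Variable F : numFieldType.
Variables (l l' : label F) (p q r s : F).
Hypotheses (adm : admissible l) (adm' : admissible l').
Hypothesis det : p * s - q * r != 0.

Lemma same_class_D0 : dot_of l = D0 -> dot_of l' = D0 ->
  tab_hom p q r s (ast_of l) (ast_of l') -> same_class l l'.
Proof.
case: l => // [||||a|a||] _; case: l' => // [||||b|b||] _ H.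
all: have := mtab_inj det (H : tab_hom p q r s (mtab _) (mtab _)).
all: by move=> E; constructor 1; congruence.
Qed.

Lemma same_class_D1 : dot_of l = D1 -> dot_of l' = D1 ->
  tab_hom p q r s (mtab D1) (mtab D1) ->
  tab_hom p q r s (ast_of l) (ast_of l') -> same_class l l'.
Proof.
move=> dl dl' /(aut_D1 det)[p1 r0 s1]; subst p r s.
case: l adm dl => //= a b A _; case: l' adm' dl' => //= c d A' _ H.
all: hom_eqs H.
all: try by same_label.
all: by exfalso; fsatz.
Qed.

Lemma same_class_D2 : dot_of l = D2 -> dot_of l' = D2 ->
  tab_hom p q r s (mtab D2) (mtab D2) ->
  tab_hom p q r s (ast_of l) (ast_of l') -> same_class l l'.
Proof.
move=> dl dl' /(aut_D2 det)[p1 r0 s1]; subst p r s.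
case: l adm dl => //= a b A _; case: l' adm' dl' => //= c d A' _ H.
all: hom_eqs H.
all: try by same_label.
all: by exfalso; fsatz.
Qed.

Lemma same_class_D3 : dot_of l = D3 -> dot_of l' = D3 ->
  tab_hom p q r s (mtab D3) (mtab D3) ->
  tab_hom p q r s (ast_of l) (ast_of l') -> same_class l l'.
Proof.
move=> dl dl' /(aut_D3 det)[r0 sp]; subst r s.
case: l adm dl => //= a A _; case: l' adm' dl' => //= c A' _ H.
all: hom_eqs H.
all: try by same_label.
all: by exfalso; fsatz.
Qed.

Lemma same_class_D4 : dot_of l = D4 -> dot_of l' = D4 ->
  tab_hom p q r s (mtab D4) (mtab D4) ->
  tab_hom p q r s (ast_of l) (ast_of l') -> same_class l l'.
Proof.
move=> dl dl' /(aut_D4 det)[q0 r0 s1]; subst q r s.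
case: l adm dl => //= a b A _; case: l' adm' dl' => //= c d A' _ H.
all: hom_eqs H.
all: try by same_label.
all: by exfalso; fsatz.
Qed.

Lemma same_class_D5 a : dot_of l = D5 a -> dot_of l' = D5 a ->
  tab_hom p q r s (mtab (D5 a)) (mtab (D5 a)) ->
  tab_hom p q r s (ast_of l) (ast_of l') -> same_class l l'.
Proof.
move=> dl dl' /(aut_D5 det)[p1 r0 qa]; subst p r.
have D5_inj (x y : F) : D5 x = D5 y -> x = y by case.
case: l adm dl => //= [c b g|c b g|c|c b||c|c b] A /D5_inj ea.
all: case: l' adm' dl' =>
  //= [c' b' g'|c' b' g'|c'|c' b'||c'|c' b'] A' /D5_inj ea' H.
all: hom_eqs H.
all: try by same_label.
all: try by exfalso; fsatz.
(* [C24] against [C25]: the equations give [s = q (g - b)], so [q] and [g - b] are nonzero, and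
   [q <> 0] forces the parameter to be [1]. *)
- have ea1 : c = 1 by fsatz.
  have eb : b' = b by fsatz.
  have eg : g' = g by fsatz.
  have gb : g != b by fsatz.
  by rewrite ea' -ea eb eg ea1; constructor 2; apply: exc24.
- have ea1 : c = 1 by fsatz.
  have eb : b' = b by fsatz.
  have eg : g' = g by fsatz.
  have gb : g != b by fsatz.
  by rewrite ea' -ea eb eg ea1; constructor 3; apply: exc24.
Qed.

Lemma same_class_D6 a : dot_of l = D6 a -> dot_of l' = D6 a ->
  tab_hom p q r s (mtab (D6 a)) (mtab (D6 a)) ->
  tab_hom p q r s (ast_of l) (ast_of l') -> same_class l l'.
Proof.
move=> dl dl' /(aut_D6 det)[p1 r0 qa]; subst p r.
have D6_inj (x y : F) : D6 x = D6 y -> x = y by case.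
case: l adm dl => //= [c b g|c b g||c b|c|c b|c] A /D6_inj ea.
all: case: l' adm' dl' =>
  //= [c' b' g'|c' b' g'||c' b'|c'|c' b'|c'] A' /D6_inj ea' H.
all: hom_eqs H.
all: try by same_label.
all: try by exfalso; fsatz.
(* [C31] against [C32]: now [s = q g], so [q] and [g] are nonzero, and [q <> 0] forces the parameter
   to be [0]. *)
- have ea1 : c = 0 by fsatz.
  have eb : b' = b by fsatz.
  have eg : g' = g by fsatz.
  have g0 : g != 0 by fsatz.
  by rewrite ea' -ea eb eg ea1; constructor 2; apply: exc31.
- have ea1 : c = 0 by fsatz.
  have eb : b' = b by fsatz.
  have eg : g' = g by fsatz.
  have g0 : g != 0 by fsatz.
  by rewrite ea' -ea eb eg ea1; constructor 3; apply: exc31.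
(* [C34] against itself: [s] is a sign and [b = s b']. *)
- have ec : c' = c by fsatz.
  have /eqP : (b' - b) * (b' + b) = 0 by fsatz.
  rewrite mulf_eq0 subr_eq0 addr_eq0 ec => /orP[]/eqP ->.
    by constructor 1.
  by constructor 2; apply: exc34.
Qed.

Lemma same_class_D7 : dot_of l = D7 -> dot_of l' = D7 ->
  tab_hom p q r s (mtab D7) (mtab D7) ->
  tab_hom p q r s (ast_of l) (ast_of l') -> same_class l l'.
Proof.
move=> dl dl' /(aut_D7 det)[[p1 q0 r0 s1]|[p0 q1 r1 s0]]; subst p q r s.
all: case: l adm dl => //= [a b c|a b] A _.
all: case: l' adm' dl' => //= [a' b' c'|a' b'] A' _ H.
all: hom_eqs H.
all: try by same_label.
all: try by exfalso; fsatz.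
- have [-> -> ->] : [/\ a' = b, b' = a & c' = - a + b + c] by split; fsatz.
  by constructor 2; apply: exc38.
- have [-> ->] : a' = b /\ b' = a by split; fsatz.
  by constructor 2; apply: exc39.
Qed.

Lemma same_class_D8 : dot_of l = D8 -> dot_of l' = D8 ->
  tab_hom p q r s (mtab D8) (mtab D8) ->
  tab_hom p q r s (ast_of l) (ast_of l') -> same_class l l'.
Proof.
move=> dl dl' /(aut_D8 det)[[p1 q0 r0 s1]|[p1 q0 r0 s1]]; subst p q r s.
all: case: l adm dl => //= [a b c|a b] A _.
all: case: l' adm' dl' => //= [a' b' c'|a' b'] A' _ H.
all: hom_eqs H.
all: try by same_label.
all: try by exfalso; fsatz.
- have [-> -> ->] : [/\ a' = 4 * c - a, b' = b - 8 * a + 16 * c & c' = c].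
    by split; fsatz.
  by constructor 2; apply: exc40.
- have [-> ->] : a' = a + 4 * b /\ b' = - b by split; fsatz.
  by constructor 2; apply: exc41.
Qed.
End LabelUniqueness.

(** By [mtab_inj] the first products agree, so the isomorphism is an automorphism of a normal form,
    and it remains to see how it acts on the second products. *)
Lemma iso_same_class (F : numFieldType) (l l' : label F) :
  admissible l -> admissible l' ->
  iso_alg (calg l) (calg l') -> same_class l l'.
Proof.
rewrite !calgE talg_isoP => adm adm' [p [q [r [s [det hd hs]]]]].
have := mtab_inj det hd; move: hd.
case E': (dot_of l') => [|||||a|a||] /[swap] E; rewrite E => hd.
- exact: same_class_D0 det E E' hs.
- exact: same_class_D1 adm adm' det E E' hd hs.
- exact: same_class_D2 adm adm' det E E' hd hs.
- exact: same_class_D3 adm adm' det E E' hd hs.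
- exact: same_class_D4 adm adm' det E E' hd hs.
- exact (same_class_D5 adm adm' det E E' hd hs).
- exact (same_class_D6 adm adm' det E E' hd hs).
- exact: same_class_D7 adm adm' det E E' hd hs.
- exact: same_class_D8 adm adm' det E E' hd hs.
Qed.

Lemma exceptional_iso (F : numFieldType) (l l' : label F) :
  exceptional l l' -> iso_alg (calg l) (calg l').
Proof.
rewrite !calgE talg_isoP.
case=> [b g gb|b g g0|a b|a b g|a b|a b g|a b] /=.
(* The first two matrices are shears with [q = 1], which determines [s]; the others are the sign
   change of [e2], the swap, and the involution of [D8]. *)
- by exists 1, 1, 0, (g - b); tab_homs.
- by exists 1, 1, 0, g; tab_homs.
- by exists 1, 0, 0, (-1); tab_homs.
- by exists 0, 1, 1, 0; tab_homs.
- by exists 0, 1, 1, 0; tab_homs.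
- by exists (-1), 4, 0, 1; tab_homs.
- by exists (-1), 4, 0, 1; tab_homs.
Qed.

Lemma same_class_iso (F : numFieldType) (l l' : label F) :
  same_class l l' -> iso_alg (calg l) (calg l').
Proof.
case=> [->|/exceptional_iso//|/exceptional_iso]; first exact: iso_alg_refl.
exact: iso_alg_sym.
Qed.

(** * Classification of pre-Lie products *)

Section Transport.
Variable F : fieldType.
Implicit Types t u v : tab F.

(* The structure constants of [t] in the basis [row2 p q], [row2 r s]. *)
Definition rebase (p q r s : F) t : tab F :=
  let x := fun m1 m2 => (m1 * s - m2 * r) / (p * s - q * r) in
  let y := fun m1 m2 => (m2 * p - m1 * q) / (p * s - q * r) in
  Tab (x (mult1 t p q p q) (mult2 t p q p q))
      (y (mult1 t p q p q) (mult2 t p q p q))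
      (x (mult1 t p q r s) (mult2 t p q r s))
      (y (mult1 t p q r s) (mult2 t p q r s))
      (x (mult1 t r s p q) (mult2 t r s p q))
      (y (mult1 t r s p q) (mult2 t r s p q))
      (x (mult1 t r s r s) (mult2 t r s r s))
      (y (mult1 t r s r s) (mult2 t r s r s)).

Lemma rebase_hom (p q r s : F) t :
  p * s - q * r != 0 -> tab_hom p q r s (rebase p q r s t) t.
Proof. by move=> nz; rewrite /tab_hom /=; do !split; field. Qed.

Definition tab_iso t u :=
  exists p q r s : F, p * s - q * r != 0 /\ tab_hom p q r s t u.

(** Pairing with the zero product makes the results on pairs available for single products. *)
Lemma tab_isoP t u :
  tab_iso t u <-> iso_alg (talg t (tab0 F)) (talg u (tab0 F)).
Proof.
rewrite talg_isoP; split=> [][p [q [r [s H]]]]; exists p, q, r, s.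
  case: H => det h; split=> //.
  by rewrite /tab_hom /mult1 /mult2 /=; do !split; ring.
by case: H.
Qed.

Lemma tab_iso_trans t u v : tab_iso t u -> tab_iso u v -> tab_iso t v.
Proof. by rewrite !tab_isoP; apply: iso_alg_trans. Qed.

Lemma tab_iso_rebase (p q r s : F) t :
  p * s - q * r != 0 -> tab_iso (rebase p q r s t) t.
Proof. by move=> nz; exists p, q, r, s; split=> //; apply: rebase_hom. Qed.

Lemma tab_iso_preLie t u : tab_iso t u -> preLie_tab u -> preLie_tab t.
Proof.
move=> /tab_isoP /iso_compatible; rewrite !talg_compatibleP => H u_pl.
have tabD0 v : tabD v (tab0 F) = v by case: v => *; rewrite /tabD /= !addr0.
case: H => //; split=> //; first by rewrite /=; split; ring.
by rewrite tabD0.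
Qed.
End Transport.

Tactic Notation "hom_with" uconstr(p) uconstr(q) uconstr(r) uconstr(s) :=
  exists p, q, r, s; tab_homs.

Section SingleClassification.
Variable F : numFieldType.
Hypothesis sqr_surj : forall x : F, exists y, y * y = x.
Implicit Types t : tab F.

(* This is [X F[X] / (X (X^2 - c X - b))] with basis [X, X^2]. *)
Lemma classify_monogenic (b c : F) :
  exists k, tab_iso (mtab k) (Tab 0 1 b c b c (b * c) (b + c * c)).
Proof.
have [d dE] := sqr_surj (c * c + 4 * b).
(* [x] and [y] are the roots of [X^2 - c X - b]. *)
pose x := (c + d) / 2; pose y := (c - d) / 2.
have cE : c = x + y by rewrite /x /y; field.
have bE : b = - (x * y).
  suff : 4 * b = 4 * - (x * y) by move/(mulfI _); apply; rewrite pnatr_eq0.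
  have -> : 4 * - (x * y) = d * d - c * c by rewrite /x /y; field.
  by rewrite dE; ring.
move: x y cE bE => x y -> -> {b c d dE}.
(* Elements are determined by their values at the roots [0], [x], [y], with derivatives at multiple
   roots. The witnesses, written in the basis [X], [X^2], interpolate the idempotents and
   nilpotents: all roots zero gives [D3], one nonzero root [D5 0], equal nonzero roots [D6 1],
   distinct nonzero roots [D7]. *)
have [->|y0] := eqVneq y 0; have [->|x0] := eqVneq x 0.
- by exists D3; hom_with 1 0 0 1.
- have [w xw] := nonzero_inv x0.
  by exists (D5 0); hom_with 0 (w * w) (- x) 1.
- have [w yw] := nonzero_inv y0.
  by exists (D5 0); hom_with 0 (w * w) (- y) 1.
have [<-|xy] := eqVneq x y.
  have [w xw] := nonzero_inv x0.
  by exists (D6 1); hom_with (2 * w) (- w * w) (- x) 1.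
have [w xw] := nonzero_inv x0; have [v yv] := nonzero_inv y0.
have [m xym] := invr_exists xy.
by exists D7; hom_with (- y * w * m) (w * m) (x * v * m) (- v * m).
Qed.

(** If some [u] is independent of [u u], associativity makes these two a basis with the table of
    [classify_monogenic]. It is enough to test [e1], [e2], [e1 + e2] and [e1 - e2]. *)
Lemma classify_comm t : preLie_tab t -> a12 t = a21 t -> b12 t = b21 t ->
  exists k, tab_iso (mtab k) t.
Proof.
move=> pl ea eb.
have cyclic x y m n : mult1 t x y x y = m -> mult2 t x y x y = n ->
    x * n - y * m != 0 -> exists k, tab_iso (mtab k) t.
  move=> mE nE det; have iso := tab_iso_rebase t det.
  have := rebase_hom t det; rewrite /tab_hom mE nE {mE nE}.
  have := tab_iso_preLie iso pl; move: iso.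
  move: (rebase _ _ _ _ t) => [A11 B11 A12 B12 A21 B21 A22 B22].
  case: t pl ea eb => c11 d11 c12 d12 c21 d21 c22 d22 /= _ <- <- {c21 d21}.
  move=> iso pl'; rewrite /mult1 /mult2 /=.
  move=> [[g1 g2] [[g3 g4] [[g5 g6] _]]].
  have eA : A11 = 0 by clear g3 g4 g5 g6; fsatz.
  have eB : B11 = 1 by clear g3 g4 g5 g6; fsatz.
  have eA2 : A21 = A12 by fsatz.
  have eB2 : B21 = B12 by fsatz.
  case: pl' => h1 h2 h3 h4; clear g1 g2 g3 g4 g5 g6 det.
  have eA3 : A22 = A12 * B12 by fsatz.
  have eB3 : B22 = A12 + B12 * B12 by fsatz.
  subst; have [k iso'] := classify_monogenic A12 B12.
  by exists k; apply: tab_iso_trans iso' iso.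
case: t pl ea eb cyclic => c11 d11 c12 d12 c21 d21 c22 d22.
rewrite /mult1 /mult2 /= => -[h1 h2 h3 h4] ea eb; subst c21 d21 => cyclic.
have [e1|] := eqVneq d11 0; last first.
  by move=> nz; apply: (cyclic 1 0 _ _ erefl erefl); fsatz.
have [e2|] := eqVneq c22 0; last first.
  by move=> nz; apply: (cyclic 0 1 _ _ erefl erefl); fsatz.
have [e3|] := eqVneq (d22 + 2 * d12) (c11 + 2 * c12); last first.
  by move=> nz; apply: (cyclic 1 1 _ _ erefl erefl); fsatz.
have [e4|] := eqVneq (d22 - 2 * d12) (2 * c12 - c11); last first.
  by move=> nz; apply: (cyclic 1 (-1) _ _ erefl erefl); fsatz.
(* All four squares being proportional, [2 x y = f(x) y + f(y) x] for a linear form [f], and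
   associativity forces [f = 0]. *)
exists D0; hom_with 1 0 0 1.
Qed.

(* Here [e2 = e1 e2 - e2 e1], so that left multiplication by [e2] is
   nilpotent. *)
Lemma classify_nonabelian (a b c d x y : F) :
  preLie_tab (Tab a b d (c + 1) d c x y) ->
  exists k, tab_iso (mtab k) (Tab a b d (c + 1) d c x y).
Proof.
case=> h1 h2 h3 h4.
have [x0|x0] := eqVneq x 0.
  (* Left multiplication by [e2] has trace [d + y] and determinant [d y - c x], both zero by
     nilpotency. *)
  have y0 : y = 0 by fsatz.
  have d0 : d = 0 by fsatz.
  subst x y d.
  have [c0|c0] := eqVneq c 0.
    subst c; have [a0|a0] := eqVneq a 0.
      by subst a; exists D4; hom_with 0 1 1 (- b).
    have [w aw] := nonzero_inv a0.
    (* Replacing [e1] by [e1 + t e2] removes [b] when [a <> 1]; for [a = 1] a nonzero [b] can only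
       be scaled to [1], which gives [D2]. Below, [c = -1] is the analogous obstruction, and gives
       [D1]. *)
    have [a1|a1] := eqVneq a 1; last first.
      have [v av] := invr_exists a1.
      by exists (D5 w); hom_with w (w * b * v) 0 1.
    subst a; have [b0|b0] := eqVneq b 0.
      by subst b; exists (D5 1); hom_with 1 0 0 1.
    by exists D2; hom_with 1 0 0 b.
  have ac : a = c by fsatz.
  subst a; have [w cw] := nonzero_inv c0.
  have [c1|c1] := eqVneq c (-1); last first.
    have [v cv] := invr_exists c1.
    by exists (D6 (1 + w)); hom_with w (- w * b * v) 0 1.
  subst c; have [b0|b0] := eqVneq b 0.
    by subst b; exists (D6 0); hom_with (-1) 0 0 1.
  by exists D1; hom_with (-1) 0 0 b.
(* In [D8] the vector [e1 - 2 e2] spans the commutators and has square [- 2 e2]. Hence it is sent to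
   [e] times the present [e2], and the [e2] of [D8] to half of [w] times the present [e2 e2];
   comparing squares requires [e * e = - w]. *)
have [w xw] := nonzero_inv x0.
have [e eE] := sqr_surj (- w).
by exists D8; hom_with 1 (y * w + e) 2^-1 (2^-1 * y * w).
Qed.

Theorem pre_Lie_classification t : preLie_tab t ->
  exists k, tab_iso (mtab k) t.
Proof.
move=> pl.
(* Here [row2 m n] is the commutator of [e1] and [e2]. The commutator of [row2 p q] with it is the
   determinant times [row2 m n], so determinant [1] gives the relation wanted by
   [classify_nonabelian]. *)
have nonabelian p q m n : a12 t = a21 t + m -> b12 t = b21 t + n ->
    p * n - q * m = 1 -> exists k, tab_iso (mtab k) t.
  move=> mE nE det1; have det : p * n - q * m != 0 by rewrite det1 oner_neq0.
  have iso := tab_iso_rebase t det.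
  have := rebase_hom t det; have := tab_iso_preLie iso pl; move: iso.
  move: (rebase _ _ _ _ t) => [A11 B11 A12 B12 A21 B21 A22 B22].
  case: t pl mE nE => c11 d11 c12 d12 c21 d21 c22 d22 /= _ -> -> iso pl'.
  rewrite /tab_hom /mult1 /mult2 /= => -[_ [[g3 g4] [[g5 g6] _]]]; clear det.
  have eA : A12 = A21 by fsatz.
  have eB : B12 = B21 + 1 by fsatz.
  subst; have [k iso'] := classify_nonabelian pl'.
  by exists k; apply: tab_iso_trans iso' iso.
have [e1|] := eqVneq (a12 t) (a21 t); last first.
  move/invr_exists=> [i iE].
  apply: (nonabelian 0 (- i) (a12 t - a21 t) (b12 t - b21 t)); fsatz.
have [e2|] := eqVneq (b12 t) (b21 t); last first.
  move/invr_exists=> [i iE].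
  apply: (nonabelian i 0 (a12 t - a21 t) (b12 t - b21 t)); fsatz.
exact: classify_comm.
Qed.
End SingleClassification.

(** * The second product *)

Section Classification.
Variable F : numFieldType.
Hypothesis sqr_surj : forall x : F, exists y, y * y = x.
Implicit Types s t : tab F.

Definition classified (t s : tab F) : Prop :=
  exists l, admissible l /\ iso_alg (calg l) (talg t s).

Lemma classifiedI l (p q r v : F) t s : admissible l ->
  p * v - q * r != 0 -> tab_hom p q r v (mtab (dot_of l)) t ->
  tab_hom p q r v (ast_of l) s -> classified t s.
Proof.
move=> adm det hd hs; exists l; split=> //.
by rewrite calgE talg_isoP; exists p, q, r, v.
Qed.

Lemma inv_sqrt (x : F) : x != 0 -> exists p, x * (p * p) = 1.
Proof.
by move=> x0; have [p pE] := sqr_surj x^-1; exists p; rewrite pE mulfV.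
Qed.

Tactic Notation "classify" uconstr(l)
    uconstr(p) uconstr(q) uconstr(r) uconstr(v) :=
  apply (@classifiedI l p q r v);
  rewrite /tab_hom /mult1 /mult2 //=; do ?split; fsatz.

Ltac pl_fsatz :=
  repeat match goal with H : and4 _ _ _ _ |- _ => destruct H end; fsatz.

(** The shear of [e1] by [q e2] changes [b] to [b + q b'], so it clears [b] unless [b' = 0]. For
    [D2] the factor of [q] is [b' - a] instead. *)
Lemma classify_D1 s : preLie_tab s -> preLie_tab (tabD (mtab D1) s) ->
  classified (mtab D1) s.
Proof.
case: s => a b a' b' c d c' d' /= H1 H2.
have e1 : c' = 0 by pl_fsatz.
have e2 : c = 0 by pl_fsatz.
have e3 : a = d by pl_fsatz.
have e4 : a' = 0 by pl_fsatz.
have e5 : d' = 0 by pl_fsatz.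
subst.
have [->|b0] := eqVneq b' 0; first by classify (C10 d b) 1 0 0 1.
have [w bw] := nonzero_inv b0.
by classify (C09 d b') 1 (- b * w) 0 1.
Qed.

Lemma classify_D2 s : preLie_tab s -> preLie_tab (tabD (mtab D2) s) ->
  classified (mtab D2) s.
Proof.
case: s => a b a' b' c d c' d' /= H1 H2.
have e1 : c' = 0 by pl_fsatz.
have e2 : c = 0 by pl_fsatz.
have e3 : d = 0 by pl_fsatz.
have e4 : a' = 0 by pl_fsatz.
have e5 : d' = 0 by pl_fsatz.
subst.
have [->|b0] := eqVneq b' a; first by classify (C12 a b) 1 0 0 1.
have [w bw] := invr_exists b0.
by classify (C11 a b') 1 (- b * w) 0 1.
Qed.

(** The automorphisms [e1 -> p e1 + q e2], [e2 -> p^2 e2] multiply [a'] and [c] by [p^2]; a square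
    root normalises whichever is nonzero, and [q] is used to clear the entry [a]. *)
Lemma classify_D3 s : preLie_tab s -> preLie_tab (tabD (mtab D3) s) ->
  classified (mtab D3) s.
Proof.
case: s => a b a' b' c d c' d' /= H1 H2.
have e1 : c' = 0 by pl_fsatz.
have e2 : d' = 2 * c - a' by pl_fsatz.
subst.
have [e3|a0] := eqVneq a' 0; last first.
  have e4 : c = a' by pl_fsatz.
  have e5 : b' = 0 by pl_fsatz.
  have e6 : d = 0 by pl_fsatz.
  subst; have [p pE] := inv_sqrt a0; clear a0.
  by classify (C18 (b + 2^-1 * 2^-1 * a * a * p * p))
    p (- 2^-1 * p * p * p * a) 0 (p * p).
have [c0|c0] := eqVneq c 0; last first.
  have e4 : a = d by pl_fsatz.
  have e5 : b' = 2 * d by pl_fsatz.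
  subst; have [p pE] := inv_sqrt c0; clear c0.
  by classify (C19 (b - d * d * p * p)) p (- p * p * p * d) 0 (p * p).
subst.
(* Now [e2] spans an ideal with [e2 e2 = 0], and [p] scales the remaining action of [e1]. When
   [d = 0] and [a <> 0], the ratio of [b'] to [a] is invariant, and [q] removes [b] unless this
   ratio is [1]. *)
have [d0|d0] := eqVneq d 0.
  subst; have [a0|a0] := eqVneq a 0.
    subst; have [b0|b0] := eqVneq b' 0.
      by subst; classify (C15 b) 1 0 0 1.
    have [w bw] := nonzero_inv b0.
    by classify (C13 0) w (- b * w * w) 0 (w * w).
  have [w aw] := nonzero_inv a0.
  have [b1|b1] := eqVneq (b' * w) 1.
    by classify (C17 b) w 0 0 (w * w).
  have [v bv] := invr_exists b1.
  by classify (C16 (b' * w)) w (- b * w * w * v) 0 (w * w).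
have e3 : a = d by pl_fsatz.
subst; have [b0|b0] := eqVneq b' 0.
  have [w dw] := nonzero_inv d0.
  by subst; classify (C14 b) w 0 0 (w * w).
have [w bw] := nonzero_inv b0.
by classify (C13 (d * w)) w (- b * w * w) 0 (w * w).
Qed.

Lemma classify_D4 s : preLie_tab s -> preLie_tab (tabD (mtab D4) s) ->
  classified (mtab D4) s.
Proof.
case: s => a b a' b' c d c' d' /= H1 H2.
have e1 : a = 0 by pl_fsatz.
have e2 : b = 0 by pl_fsatz.
have e3 : b' = 0 by pl_fsatz.
have e4 : d = 0 by pl_fsatz.
subst.
have [a0|a0] := eqVneq a' 0; have [c0|c0] := eqVneq c' 0.
- by subst; classify (C21 c d') 1 0 0 1.
- by subst; classify (C20 c d') c' 0 0 1.
- have e5 : d' = a' by pl_fsatz.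
  by subst; classify (C23 a' c) 1 0 0 1.
- have e5 : d' = a' by pl_fsatz.
  by subst; classify (C22 a' c) c' 0 0 1.
Qed.

(** [generic] covers the solutions that exist for every [k]; further ones occur only for [k] equal
    to [1/2], [1] or [0]. Scaling [e2] normalises one coefficient. *)
Lemma classify_D5 k s : preLie_tab s -> preLie_tab (tabD (mtab (D5 k)) s) ->
  classified (mtab (D5 k)) s.
Proof.
case: s => a b a' b' c d c' d' /= H1 H2.
have d0 : d = 0 by pl_fsatz.
have ea' : a' = (1 - k) * c by pl_fsatz.
subst.
have generic : c = 0 -> c' = 0 -> d' = 0 ->
    classified (mtab (D5 k)) (Tab a b ((1 - k) * c) b' c 0 c' d').
  move=> c0 c'0 d'0; subst.
  have [b0|b0] := eqVneq b 0.
    by subst; classify (C25 k a b') 1 0 0 1.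
  by classify (C24 k a b') 1 0 0 b.
have [k2|k2] := eqVneq k 2^-1.
  subst; have ed' : d' = 2^-1 * c by pl_fsatz.
  subst; have [c0|c0] := eqVneq c 0.
    have [c'0|c'0] := eqVneq c' 0; first by apply: generic => //; pl_fsatz.
    have b0 : b = 0 by pl_fsatz.
    have [v vE] := inv_sqrt c'0.
    have ea : a = 2 * b' by pl_fsatz.
    by subst; classify (C26 b') 1 0 0 v.
  have b0 : b = 0 by pl_fsatz.
  have ea : a = 2 * b' by pl_fsatz.
  have [w cw] := nonzero_inv c0.
  by subst; classify (C27 b' (4 * w * w * c')) 1 0 0 (2 * w).
have c'0 : c' = 0 by pl_fsatz.
subst; have [c0|c0] := eqVneq c 0.
  subst; have [k0|k0] := eqVneq k 0; last by apply: generic => //; pl_fsatz.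
  subst; have [d'0|d'0] := eqVneq d' 0; first exact: generic.
  have e1 : b' = 0 by pl_fsatz.
  have e2 : b = 0 by pl_fsatz.
  have [w dw] := nonzero_inv d'0.
  by subst; classify (C29 a) 1 0 0 w.
have [w cw] := nonzero_inv c0.
have [k1|k1] := eqVneq k 1.
  subst; have e1 : d' = c by pl_fsatz.
  have e2 : b = 0 by pl_fsatz.
  have e3 : b' = a by pl_fsatz.
  (* Here [x y = f(x) y] with [f(e1) = a] and [f(e2) = c]; the shear allowed at [k = 1] moves [e1]
     into the kernel of [f]. *)
  by subst; classify C28 1 (- a * w) 0 w.
have k0 : k = 0 by pl_fsatz.
subst; have e1 : d' = c by pl_fsatz.
have e2 : b' = 0 by pl_fsatz.
by subst; classify (C30 a (b * c)) 1 0 0 w.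
Qed.

(** As for [D5], with exceptional values [1], [2] and [0] of [k]. In the last case [x y = f(y) x],
    and the shear allowed at [k = 0] moves [e1] into the kernel of [f]. *)
Lemma classify_D6 k s : preLie_tab s -> preLie_tab (tabD (mtab (D6 k)) s) ->
  classified (mtab (D6 k)) s.
Proof.
case: s => a b a' b' c d c' d' /= H1 H2.
have da : d = a by pl_fsatz.
subst.
have generic : a' = 0 -> c = 0 -> c' = 0 -> d' = 0 ->
    classified (mtab (D6 k)) (Tab a b a' b' c a c' d').
  move=> a'0 c0 c'0 d'0; subst.
  have [b0|b0] := eqVneq b 0.
    by subst; classify (C32 k a b') 1 0 0 1.
  by classify (C31 k a b') 1 0 0 b.
have [k1|k1] := eqVneq k 1.
  subst; have c0 : c = 0 by pl_fsatz.
  have a'0 : a' = 0 by pl_fsatz.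
  subst; have [c'0|c'0] := eqVneq c' 0.
    subst; have [d'0|d'0] := eqVneq d' 0; first exact: generic.
    have e1 : b = 0 by pl_fsatz.
    have e2 : b' = a by pl_fsatz.
    have [w dw] := nonzero_inv d'0.
    by subst; classify (C35 a) 1 0 0 w.
  have e1 : b = 0 by pl_fsatz.
  have e2 : b' = a by pl_fsatz.
  have [v vE] := inv_sqrt c'0.
  by subst; classify (C34 a (v * d')) 1 0 0 v.
have c'0 : c' = 0 by pl_fsatz.
subst; have [k2|k2] := eqVneq k 2.
  subst; have [a'0|a'0] := eqVneq a' 0.
    have e1 : d' = 2 * c by pl_fsatz.
    subst; have [c0|c0] := eqVneq c 0.
      by subst; apply: generic => //; rewrite mulr0.
    have e1 : b' = 2 * a by pl_fsatz.
    have [w cw] := nonzero_inv c0.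
    by subst; classify (C36 a (b * c)) 1 0 0 w.
  have e1 : c = 2 * a' by pl_fsatz.
  have e2 : d' = a' by pl_fsatz.
  have e3 : b = 0 by pl_fsatz.
  have e4 : b' = 2 * a by pl_fsatz.
  have [w aw] := nonzero_inv a'0.
  by subst; classify (C37 a) 1 0 0 w.
have c0 : c = 0 by pl_fsatz.
subst; have [a'0|a'0] := eqVneq a' 0.
  by apply: generic => //; pl_fsatz.
have [w aw] := nonzero_inv a'0.
have k0 : k = 0 by pl_fsatz.
have e1 : d' = a' by pl_fsatz.
have e2 : b = 0 by pl_fsatz.
have e3 : b' = 0 by pl_fsatz.
by subst; classify C33 1 (- a * w) 0 w.
Qed.

(** The automorphism group is finite, here and for [D8], so no coefficient can be normalised: the
    two branches of the quadratic equations are the two families. *)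
Lemma classify_D7 s : preLie_tab s -> preLie_tab (tabD (mtab D7) s) ->
  classified (mtab D7) s.
Proof.
case: s => a b a' b' c d c' d' /= H1 H2.
have e1 : c = a' by pl_fsatz.
have e2 : c' = - a' by pl_fsatz.
have e3 : d = b' by pl_fsatz.
have e4 : b = - b' by pl_fsatz.
subst; have [ea|ea] := eqVneq a (d' + b' - a').
  by subst; classify (C38 a' b' d') 1 0 0 1.
have e5 : a' = 0 by pl_fsatz.
have e6 : b' = 0 by pl_fsatz.
by subst; classify (C39 a d') 1 0 0 1.
Qed.

Lemma classify_D8 s : preLie_tab s -> preLie_tab (tabD (mtab D8) s) ->
  classified (mtab D8) s.
Proof.
case: s => a b a' b' c d c' d' /= H1 H2.
have e1 : d = a by pl_fsatz.
have e2 : b' = 2 * a by pl_fsatz.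
have e3 : c' = 2^-1 * a' by pl_fsatz.
have e4 : d' = 2 * c - 3 * a' by pl_fsatz.
subst; have [a0|a0] := eqVneq a' 0.
  by subst; classify (C40 a b c) 1 0 0 1.
have e5 : b = 0 by pl_fsatz.
have e6 : c = 2 * a' + 2^-1 * a by pl_fsatz.
by subst; classify (C41 a a') 1 0 0 1.
Qed.
End Classification.

(** * Classification of pairs of products *)

Section CompatibleClassification.
Variable F : numFieldType.
Hypothesis sqr_surj : forall x : F, exists y, y * y = x.

Lemma tab_iso0 (t : tab F) : tab_iso (tab0 F) t -> t = tab0 F.
Proof.
move=> /tab_isoP /iso_alg_sym /iso_nonzero; rewrite !talg_nonzeroP => nz.
by apply: boolp.contrapT => t0; case: nz; [left|..].
Qed.

(** The matrix that brings [d] to normal form also transports [s]. If [d = 0], the classification of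
    single products is applied to [s] instead. *)
Lemma talg_classified (d s : tab F) :
  compatible_pre_Lie (talg d s) -> nonzero_alg (talg d s) -> classified d s.
Proof.
move=> pl /talg_nonzeroP nz.
have [d_pl s_pl _] : [/\ preLie_tab d, preLie_tab s & preLie_tab (tabD d s)].
  exact/talg_compatibleP.
have [k iso_k] := pre_Lie_classification sqr_surj d_pl.
case: (iso_k) => p [q [r [v [det hd]]]].
have iso : iso_alg (talg (mtab k) (rebase p q r v s)) (talg d s).
  by rewrite talg_isoP; exists p, q, r, v; split=> //; apply: rebase_hom.
have /talg_compatibleP[_ s'_pl ds'_pl] := iso_compatible iso pl.
have of_rebase : classified (mtab k) (rebase p q r v s) -> classified d s.
  by case=> l [adm iso_l]; exists l; split; last exact: iso_alg_trans iso_l iso.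
case: k iso_k s'_pl ds'_pl of_rebase {hd iso} =>
  [|||||a|a||] iso_k s'_pl ds'_pl.
- move=> _; have d0 : d = tab0 F by apply: tab_iso0.
  case: nz => // s0; subst d.
  have [k] := pre_Lie_classification sqr_surj s_pl.
  move=> [p' [q' [r' [v' [det' hs]]]]].
  have h0 : tab_hom p' q' r' v' (tab0 F) (tab0 F).
    by rewrite /tab_hom /mult1 /mult2 /=; do !split; ring.
  case: k hs => [|||||a|a||] hs.
  + by case: s0; apply: tab_iso0; exists p', q', r', v'.
  + exact: (@classifiedI _ C01 p' q' r' v').
  + exact: (@classifiedI _ C02 p' q' r' v').
  + exact: (@classifiedI _ C03 p' q' r' v').
  + exact: (@classifiedI _ C04 p' q' r' v').
  + exact: (@classifiedI _ (C05 a) p' q' r' v').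
  + exact: (@classifiedI _ (C06 a) p' q' r' v').
  + exact: (@classifiedI _ C07 p' q' r' v').
  + exact: (@classifiedI _ C08 p' q' r' v').
- by apply; apply: classify_D1.
- by apply; apply: classify_D2.
- by apply; apply: classify_D3.
- by apply; apply: classify_D4.
- by apply; apply: classify_D5.
- by apply; apply: classify_D6.
- by apply; apply: classify_D7.
- by apply; apply: classify_D8.
Qed.

Lemma compatible_classified (A : two_mult_alg F) :
  compatible_pre_Lie A -> \dim {: A} = 2%N -> nonzero_alg A ->
  exists l, admissible l /\ iso_alg A (calg l).
Proof.
move=> pl dimA nz; have [d [s iso]] := iso_talg_exists dimA.
have [|l [adm iso_l]] := @talg_classified d s _ (iso_nonzero iso nz).
  exact: iso_compatible (iso_alg_sym iso) pl.
by exists l; split=> //; apply: iso_alg_trans iso (iso_alg_sym iso_l).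
Qed.
End CompatibleClassification.

Theorem theoremA1 (R : realType) :
  [/\ exists A : nat -> two_mult_alg R[i],
        (forall n, compatible_pre_Lie (A n) /\ \dim {: A n} = 2%N) /\
        (forall m n, iso_alg (A m) (A n) -> m = n),
      forall l : label R[i], admissible l ->
        [/\ compatible_pre_Lie (calg l), \dim {: calg l} = 2%N
          & nonzero_alg (calg l)],
      forall A : two_mult_alg R[i],
        compatible_pre_Lie A -> \dim {: A} = 2%N -> nonzero_alg A ->
        exists l : label R[i],
          [/\ admissible l, iso_alg A (calg l)
            & forall l' : label R[i], admissible l' ->
                iso_alg A (calg l') -> same_class l l']
    & forall l l' : label R[i], admissible l -> admissible l' ->
        (iso_alg (calg l) (calg l') <-> same_class l l')].
Proof.
split.
(* No exception involves [C05], and natural numbers embed in characteristic zero. *)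
- exists (fun n => calg (C05 n%:R)); split=> [n|m n].
    by split; [exact: calg_compatible|rewrite calgE dim_talg].
  move=> /(@iso_same_class _ (C05 _) (C05 _) isT isT)[E|E|E].
  + by move: E => -[/eqP]; rewrite eqr_nat => /eqP.
  + by inversion E.
  + by inversion E.
- move=> l _; split; first exact: calg_compatible.
    by rewrite calgE dim_talg.
  exact: calg_nonzero.
- move=> A pl dimA nz.
  have sqr_surj (x : R[i]) : exists y, y * y = x.
    by exists (sqrtC x); rewrite -expr2 sqrtCK.
  have [l [adm iso_l]] := compatible_classified sqr_surj pl dimA nz.
  exists l; split=> // l' adm' iso_l'; apply: iso_same_class => //.
  exact: iso_alg_trans (iso_alg_sym iso_l) iso_l'.
- by move=> l l' adm adm'; split;
    [exact: iso_same_class|exact: same_class_iso].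
Qed.
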